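(* Let $\mathcal B$ be an $\infty$-bicategory, $(X,E_X)$ a marked simplicial set and $f\colon(X,T_X)\to\mathcal B$ a map of scaled simplicial sets which detects thin triangles. The object of $(\mathrm{Set}^{+,\mathrm{sc}}_\Delta)_{/\mathcal B}$ determined by $(X,E_X,T_X)$ and $f$ has the right lifting property with respect to outer cartesian anodyne maps if and only if $f\colon(X,T_X)\to\mathcal B$ is an outer cartesian fibration and $E_X$ is the collection of $f$-cartesian edges of $X$.
   Context: A scaled simplicial set is a pair $(X,T_X)$ of a simplicial set and a set $T_X$ of 2-simplices (thin triangles) containing the degenerate ones; maps preserve thin triangles. $(X,T)$ means: thin triangles are those of $T$ and the degenerate ones; $T_{|L}$ is the set of triangles of $L\subseteq X$ lying in $T$; $X_\sharp$ has all triangles thin. An $\infty$-bicategory is a scaled simplicial set with the extension property against: (i) $(\Lambda^n_i,\{\Delta^{\{i-1,i,i+1\}}\}_{|\Lambda^n_i})\to(\Delta^n,\{\Delta^{\{i-1,i,i+1\}}\})$, $0<i<n$; (ii) $(\Delta^4,T)\to(\Delta^4,T\cup\{\Delta^{\{0,3,4\}},\Delta^{\{0,1,4\}}\})$, $T=\{\Delta^{\{0,2,4\}},\Delta^{\{1,2,3\}},\Delta^{\{0,1,3\}},\Delta^{\{1,3,4\}},\Delta^{\{0,1,2\}}\}$; (iii) $(\Lambda^n_0\coprod_{\Delta^{\{0,1\}}}\Delta^0,\{\Delta^{\{0,1,n\}}\})\to(\Delta^n\coprod_{\Delta^{\{0,1\}}}\Delta^0,\{\Delta^{\{0,1,n\}}\})$,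 $n\ge3$. A weak fibration is a map of scaled simplicial sets with the right lifting property against the maps (i) and against $(\Lambda^n_0\coprod_{\Delta^{\{0,1\}}}\Delta^0,\{\Delta^{\{0,1,n\}}\}_{|\Lambda^n_0})\subseteq(\Delta^n\coprod_{\Delta^{\{0,1\}}}\Delta^0,\{\Delta^{\{0,1,n\}}\})$ and $(\Lambda^n_n\coprod_{\Delta^{\{n-1,n\}}}\Delta^0,\{\Delta^{\{0,n-1,n\}}\}_{|\Lambda^n_n})\subseteq(\Delta^n\coprod_{\Delta^{\{n-1,n\}}}\Delta^0,\{\Delta^{\{0,n-1,n\}}\})$, $n\ge2$. A map detects thin triangles if a triangle is thin iff its image is. A weak fibration is an outer fibration if it detects thin triangles and its underlying map has the right lifting property against $\Lambda^n_0\coprod_{\Delta^{\{0,1\}}}\Delta^0\subseteq\Delta^n\coprod_{\Delta^{\{0,1\}}}\Delta^0$ and $\Lambda^n_n\coprod_{\Delta^{\{n-1,n\}}}\Delta^0\subseteq\Delta^n\coprod_{\Delta^{\{n-1,n\}}}\Delta^0$, $n\ge2$. An edge $e$ is $f$-cartesian if every square from $(\Lambda^n_n,\{\Delta^{\{0,n-1,n\}}\}_{|\Lambda^n_n})\subseteq(\Delta^n,\{\Delta^{\{0,n-1,n\}}\})$, $n\ge2$, to $f$ whose top map sends $\Delta^{\{n-1,n\}}$ to $e$ has a lift. An outer cartesian fibration is an outer fibration $f\colon X\to Y$ such that every edge $y\to f(x)$ has an $f$-cartesian lift with target $x$. A marked-scaled simplicial set is a triple $(X,E_X,T_X)$ with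 a set $E_X$ of (marked) edges and a set $T_X$ of (thin) triangles; degenerate edges (triangles) are always marked (thin) and are omitted from notation, e.g. $\emptyset$ means only degenerate ones. ${}^\flat\Delta^2$, ${}^\sharp\Delta^2$: minimal, resp. maximal, marking and scaling. $(\mathrm{Set}^{+,\mathrm{sc}}_\Delta)_{/(S,T_S)}$ is the category of marked-scaled simplicial sets $(X,E_X,T_X)$ with a map of scaled simplicial sets $(X,T_X)\to(S,T_S)$. An object $X$ of it has the right lifting property with respect to $A\to A'$ (a map over $S$) if every map $A\to X$ over $S$ extends to a map $A'\to X$ over $S$. The outer cartesian anodyne maps are the smallest weakly saturated class of maps in $(\mathrm{Set}^{+,\mathrm{sc}}_\Delta)_{/(S,T_S)}$ containing: (1) $(\Lambda^n_i,\emptyset,\{\Delta^{\{i-1,i,i+1\}}\}_{|\Lambda^n_i})\hookrightarrow(\Delta^n,\emptyset,\{\Delta^{\{i-1,i,i+1\}}\})$ for $0<i<n$ and every map $(\Delta^n,\{\Delta^{\{i-1,i,i+1\}}\})\to(S,T_S)$; (2) $(\Lambda^n_n,\{\Delta^{\{n-1,n\}}\},\emptyset)\subseteq(\Delta^n,\{\Delta^{\{n-1,n\}}\},\emptyset)$ for $n\ge1$ and every map $\Delta^n\to S$ (for $n=1$ this is $\Delta^{\{1\}}\subseteq(\Delta^1)^\sharp$, with all edges marked); (3) $(\Lambda^n_0\coprod_{\Delta^{\{0,1\}}}\Delta^0,\emptyset,\emptyset)\subseteq(\Delta^n\coprod_{\Delta^{\{0,1\}}}\Delta^0,\emptyset,\emptyset)$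 for $n\ge2$ and every map $\Delta^n\coprod_{\Delta^{\{0,1\}}}\Delta^0\to S$; (4) ${}^\flat\Delta^2\subseteq(\Delta^2,\emptyset,\{\Delta^2\})$ for every map $\Delta^2_\sharp\to(S,T_S)$; (5) $(Q,\emptyset,Q_2)\subseteq(Q,E,Q_2)$ for every map $Q_\sharp\to(S,T_S)$, where $Q=\Delta^0\coprod_{\Delta^{\{0,2\}}}\Delta^3\coprod_{\Delta^{\{1,3\}}}\Delta^0$ and $E$ consists of the degenerate edges together with $\Delta^{\{0,1\}}$ and $\Delta^{\{0,3\}}$; (6) $(\Delta^2,\{\Delta^{\{0,1\}},\Delta^{\{1,2\}}\},\{\Delta^2\})\subseteq{}^\sharp\Delta^2$ for every map $\Delta^2_\sharp\to(S,T_S)$. *)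

(* Defs.v *)
From Stdlib Require Import Relations.
From HB Require Import structures.
From mathcomp Require Import all_boot.
From mathcomp Require Import generic_quotient boolp.

Set Implicit Arguments.
Unset Strict Implicit.
Unset Printing Implicit Defensive.

Record category := Category {
  obj :> Type;
  hom : obj -> obj -> Type;
  idm : forall A, hom A A;
  compm : forall A B C, hom B C -> hom A B -> hom A C;
  comp1m : forall A B (f : hom A B), compm (idm B) f = f;
  compm1 : forall A B (f : hom A B), compm f (idm A) = f;
  compA : forall A B C D (h : hom C D) (g : hom B C) (f : hom A B),
    compm h (compm g f) = compm (compm h g) f }.

Arguments hom {_} A B.
Arguments idm {_} A.
Arguments compm {_ A B C} g f.

Declare Scope cat_scope.
Delimit Scope cat_scope with cat.
Notation "g ∘ f" := (compm g f) (at level 40, left associativity) : cat_scope.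
Local Open Scope cat_scope.

Section Lifting.
Variable C : category.

Definition has_lifting (A B X Y : C) (j : hom A B) (p : hom X Y) : Prop :=
  forall (u : hom A X) (v : hom B Y), p ∘ u = v ∘ j ->
    exists h : hom B X, h ∘ j = u /\ p ∘ h = v.

Definition has_extension (A B : C) (j : hom A B) (X : C) : Prop :=
  forall u : hom A X, exists h : hom B X, h ∘ j = u.

Definition is_pushout (A B A' B' : C) (f : hom A B) (g : hom A A')
    (f' : hom A' B') (g' : hom B B') : Prop :=
  g' ∘ f = f' ∘ g /\
  forall (Z : C) (u : hom B Z) (v : hom A' Z), u ∘ f = v ∘ g ->
    exists! w : hom B' Z, w ∘ g' = u /\ w ∘ f' = v.

Definition is_retract (A B A' B' : C) (f : hom A B) (g : hom A' B') : Prop :=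
  exists (i : hom A A') (r : hom A' A) (i' : hom B B') (r' : hom B' B),
    [/\ r ∘ i = idm A, r' ∘ i' = idm B, g ∘ i = i' ∘ f & f ∘ r = r' ∘ g].

(* A diagram in the coslice under A, indexed by a well-ordered set. *)
Record chain (A : C) := Chain {
  idx : Type;
  idx_lt : idx -> idx -> Prop;
  lt_wf : well_founded idx_lt;
  lt_trans : forall i j k, idx_lt i j -> idx_lt j k -> idx_lt i k;
  lt_total : forall i j, [\/ idx_lt i j, i = j | idx_lt j i];
  ob : idx -> C;
  from : forall i, hom A (ob i);
  step : forall i j, idx_lt i j -> hom (ob i) (ob j);
  step_from : forall i j (ij : idx_lt i j), step ij ∘ from i = from j;
  step_step : forall i j k (ij : idx_lt i j) (jk : idx_lt j k) (ik : idx_lt i k),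
    step jk ∘ step ij = step ik }.

(* Cocones, in the coslice under A, on the restriction of D to the indices
   satisfying P. *)
Record cocone (A : C) (D : chain A) (P : idx D -> Prop) (L : C) := Cocone {
  base : hom A L;
  leg : forall i, P i -> hom (ob i) L;
  leg_from : forall i (Pi : P i), leg Pi ∘ from i = base;
  leg_step : forall i j (Pi : P i) (Pj : P j) (ij : idx_lt i j),
    leg Pj ∘ step ij = leg Pi }.

Definition cocone_map (A : C) (D : chain A) (P : idx D -> Prop) (L L' : C)
    (k : cocone P L) (k' : cocone P L') (u : hom L L') : Prop :=
  u ∘ base k = base k' /\ forall i (Pi : P i), u ∘ leg k Pi = leg k' Pi.

Definition is_colimit (A : C) (D : chain A) (P : idx D -> Prop) (L : C)
    (k : cocone P L) : Prop :=
  forall (L' : C) (k' : cocone P L'), exists! u : hom L L', cocone_map k k' u.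

Definition cocone_at (A : C) (D : chain A) (i : idx D) :
    cocone (fun j => idx_lt j i) (ob i) :=
  @Cocone A D (fun j => idx_lt j i) (ob i) (from i) (fun j ji => step ji)
    (fun j ji => step_from ji) (fun j k ji ki jk => step_step jk ki ji).

(* If, for every i, the map  colim_(j < i) D_j -> D_i  is in W, then so is the
   map  A -> colim_j D_j  (colimits being taken under A; so for minimal i the
   former map is A -> D_i). *)
Definition closed_transfinite
    (W : forall A B : C, hom A B -> Prop) : Prop :=
  forall (A : C) (D : chain A),
    (forall i : idx D, exists (L : C) (k : cocone (fun j => idx_lt j i) L)
        (t : hom L (ob i)),
        [/\ is_colimit k, cocone_map k (cocone_at i) t & W _ _ t]) ->
    forall (L : C) (k : cocone (fun _ : idx D => True) L),
      is_colimit k -> W _ _ (base k).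

Definition closed_pushout (W : forall A B : C, hom A B -> Prop) : Prop :=
  forall (A B A' B' : C) (f : hom A B) (g : hom A A')
      (f' : hom A' B') (g' : hom B B'),
    is_pushout f g f' g' -> W _ _ f -> W _ _ f'.

Definition closed_retract (W : forall A B : C, hom A B -> Prop) : Prop :=
  forall (A B A' B' : C) (f : hom A B) (g : hom A' B'),
    is_retract f g -> W _ _ g -> W _ _ f.

Definition weakly_saturated (W : forall A B : C, hom A B -> Prop) : Prop :=
  [/\ closed_pushout W, closed_transfinite W & closed_retract W].

Definition saturation (G : forall A B : C, hom A B -> Prop)
    (A B : C) (f : hom A B) : Prop :=
  forall W : forall A B : C, hom A B -> Prop,
    weakly_saturated W -> (forall A' B' (g : hom A' B'), G _ _ g -> W _ _ g) ->
    W _ _ f.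

End Lifting.

Definition monotone m n (f : {ffun 'I_m.+1 -> 'I_n.+1}) : bool :=
  [forall i : 'I_m.+1, forall j : 'I_m.+1, (i <= j) ==> (f i <= f j)].

(* ord_map m n is the set of maps [m] -> [n]. *)
Record ord_map (m n : nat) := OrdMap {
  ord_fun :> {ffun 'I_m.+1 -> 'I_n.+1};
  ord_mono : monotone ord_fun }.

HB.instance Definition _ m n := [isSub for @ord_fun m n].
HB.instance Definition _ m n := [Finite of ord_map m n by <:].

Lemma ord_mapP m n (s : ord_map m n) (i j : 'I_m.+1) : i <= j -> s i <= s j.
Proof. by case: s => f /= /forallP/(_ i)/forallP/(_ j)/implyP; apply. Qed.

Lemma ord_map_eq m n (s t : ord_map m n) : s =1 t -> s = t.
Proof. by move=> st; apply: val_inj; apply/ffunP. Qed.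

Lemma ord_id_mono n : monotone [ffun i : 'I_n.+1 => i].
Proof. by apply/forallP=> i; apply/forallP=> j; rewrite !ffunE; apply/implyP. Qed.
Definition ord_id n : ord_map n n := OrdMap (ord_id_mono n).

Lemma ord_comp_mono l m n (s : ord_map m n) (t : ord_map l m) :
  monotone [ffun i => s (t i)].
Proof.
apply/forallP=> i; apply/forallP=> j; rewrite !ffunE; apply/implyP => ij.
by do 2!apply: ord_mapP.
Qed.
Definition ord_comp l m n (s : ord_map m n) (t : ord_map l m) : ord_map l n :=
  OrdMap (ord_comp_mono s t).

Lemma ord_const_mono m n (j : 'I_n.+1) : monotone [ffun _ : 'I_m.+1 => j].
Proof. by apply/forallP=> i; apply/forallP=> k; rewrite !ffunE leqnn implybT. Qed.
Definition ord_const m n (j : 'I_n.+1) : ord_map m n :=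
  OrdMap (ord_const_mono m j).

(* The list [:: s 0; ...; s m]. *)
Definition verts m n (s : ord_map m n) : seq nat :=
  [seq val (s i) | i <- enum 'I_m.+1].

Lemma verts_comp l m n (s : ord_map m n) (t : ord_map l m) :
  {subset verts (ord_comp s t) <= verts s}.
Proof.
by move=> _ /mapP[i _ ->]; rewrite ffunE; apply: map_f; rewrite mem_enum.
Qed.

Record sSet := SSet {
  simplices :> nat -> Type;
  act : forall m n, ord_map m n -> simplices n -> simplices m;
  act_id : forall n (x : simplices n), act (ord_id n) x = x;
  act_comp : forall l m n (s : ord_map m n) (t : ord_map l m)
    (x : simplices n), act (ord_comp s t) x = act t (act s x) }.

Arguments act {_ m n} _ _.

Record sMap (X Y : sSet) := SMap {
  app :> forall n, X n -> Y n;
  app_act : forall m n (s : ord_map m n) (x : X n),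
    app (act s x) = act s (app x) }.

Lemma sMap_eq (X Y : sSet) (f g : sMap X Y) :
  (forall n (x : X n), f n x = g n x) -> f = g.
Proof.
case: f g => [f f1] [g g1] /= fg.
have E : f = g by apply: functional_extensionality_dep => n; apply: funext.
by case: _ / E in g1 *; congr SMap; apply: Prop_irrelevance.
Qed.

Definition sMap_id (X : sSet) : sMap X X :=
  @SMap X X (fun _ x => x) (fun _ _ _ _ => erefl).

Lemma sMap_comp_subproof (X Y Z : sSet) (g : sMap Y Z) (f : sMap X Y) m n
    (s : ord_map m n) (x : X n) :
  g m (f m (act s x)) = act s (g n (f n x)).
Proof. by rewrite !app_act. Qed.
Definition sMap_comp (X Y Z : sSet) (g : sMap Y Z) (f : sMap X Y) : sMap X Z :=
  SMap (@sMap_comp_subproof X Y Z g f).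

Definition sSetCat : category.
Proof.
by apply: (@Category sSet sMap sMap_id sMap_comp) => *; apply: sMap_eq.
Defined.

Definition degenerate (X : sSet) n (x : X n) : Prop :=
  exists m (s : ord_map n m) (y : X m), m < n /\ x = act s y.

Lemma degenerate_map (X Y : sSet) (f : sMap X Y) n (x : X n) :
  degenerate x -> degenerate (f n x).
Proof.
by case=> m [s [y [mn ->]]]; exists m, s, (f m y); split=> //; rewrite app_act.
Qed.

Lemma ord_comp_id l m (s : ord_map l m) : ord_comp (ord_id m) s = s.
Proof. by apply: ord_map_eq => i; rewrite !ffunE. Qed.
Lemma ord_id_comp l m (s : ord_map l m) : ord_comp s (ord_id l) = s.
Proof. by apply: ord_map_eq => i; rewrite !ffunE. Qed.
Lemma ord_compA k l m n (s : ord_map m n) (t : ord_map l m) (r : ord_map k l) :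
  ord_comp s (ord_comp t r) = ord_comp (ord_comp s t) r.
Proof. by apply: ord_map_eq => i; rewrite !ffunE. Qed.

Definition Delta (n : nat) : sSet :=
  @SSet (fun m => ord_map m n) (fun l m t s => ord_comp s t)
    (fun m s => ord_id_comp s) (fun k l m t r s => ord_compA s t r).

Lemma to_Delta0_subproof (X : sSet) m n (s : ord_map m n) (x : X n) :
  ord_const m (ord0 : 'I_1) = ord_comp (ord_const n (ord0 : 'I_1)) s.
Proof. by apply: ord_map_eq => i; rewrite !ffunE. Qed.
Definition to_Delta0 (X : sSet) : sMap X (Delta 0) :=
  @SMap X (Delta 0) (fun n _ => ord_const n ord0) (@to_Delta0_subproof X).

(* The value of the edge e at the vertex j of [1]. *)
Definition endpoint (X : sSet) (e : X 1) (j : 'I_2) : X 0 :=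
  act (ord_const 0 j) e.
Definition target (X : sSet) (e : X 1) : X 0 := endpoint e ord_max.

Record subS (X : sSet) := SubS {
  inS :> forall n, X n -> Prop;
  inS_act : forall m n (s : ord_map m n) (x : X n), inS x -> inS (act s x) }.

Section SubObject.
Variables (X : sSet) (K : subS X).

Definition sub_act m n (s : ord_map m n) (x : {x : X n | K n x}) :
    {x : X m | K m x} :=
  exist _ (act s (sval x)) (inS_act s (svalP x)).

Lemma sub_act_id n (x : {x : X n | K n x}) : sub_act (ord_id n) x = x.
Proof. by case: x => x Kx; apply: eq_exist; rewrite act_id. Qed.

Lemma sub_act_comp l m n (s : ord_map m n) (t : ord_map l m)
    (x : {x : X n | K n x}) :
  sub_act (ord_comp s t) x = sub_act t (sub_act s x).
Proof. by apply: eq_exist; rewrite act_comp. Qed.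

Definition sub_sSet : sSet := SSet sub_act_id sub_act_comp.

Definition incl : sMap sub_sSet X :=
  @SMap sub_sSet X (fun n x => sval x) (fun _ _ _ _ => erefl).

End SubObject.

Lemma preim_subproof (X Y : sSet) (f : sMap X Y) (K : subS Y) m n
    (s : ord_map m n) (x : X n) : K n (f n x) -> K m (f m (act s x)).
Proof. by rewrite app_act; apply: inS_act. Qed.
Definition preim_subS (X Y : sSet) (f : sMap X Y) (K : subS Y) : subS X :=
  SubS (@preim_subproof X Y f K).

Definition preim_map (X Y : sSet) (f : sMap X Y) (K : subS Y) :
  sMap (sub_sSet (preim_subS f K)) (sub_sSet K).
Proof.
exists (fun n (x : {x : X n | K n (f n x)}) =>
  exist (K n) (f n (sval x)) (svalP x)) => m n s x.
by apply: eq_exist; rewrite app_act.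
Defined.

(* The face Δ^I of Δ^n, for I a list of vertices. *)
Lemma face_subproof n (I : seq nat) l m (t : ord_map l m) (s : Delta n m) :
  {subset verts s <= I} -> {subset verts (act t s) <= I}.
Proof. by move=> sI i /verts_comp; apply: sI. Qed.
Definition face (n : nat) (I : seq nat) : subS (Delta n) :=
  SubS (@face_subproof n I).

Lemma horn_subproof n i l m (t : ord_map l m) (s : Delta n m) :
  (exists j, [/\ j <= n, j != i & j \notin verts s]) ->
  exists j, [/\ j <= n, j != i & j \notin verts (act t s)].
Proof.
case=> j [jn ji js]; exists j; split=> //.
by apply: contra js; apply: verts_comp.
Qed.
Definition horn (n i : nat) : subS (Delta n) := SubS (@horn_subproof n i).

Definition Lambda (n i : nat) : sSet := sub_sSet (horn n i).
Definition horn_incl (n i : nat) : sMap (Lambda n i) (Delta n) :=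
  incl (horn n i).

Section Pushout.
Local Open Scope quotient_scope.
Variables (A B C : sSet) (f : sMap A B) (g : sMap A C).

Definition glue n : relation (B n + C n) :=
  clos_refl_sym_trans _
    (fun x y => exists a : A n, x = inl (f n a) /\ y = inr (g n a)).

Definition glueb n (x y : {classic (B n + C n)%type}) : bool := `[< glue x y >].

Lemma glueb_refl n : reflexive (@glueb n).
Proof. by move=> x; apply/asboolP; apply: rst_refl. Qed.
Lemma glueb_sym n : symmetric (@glueb n).
Proof. by move=> x y; apply/asboolP/asboolP; apply: rst_sym. Qed.
Lemma glueb_trans n : transitive (@glueb n).
Proof. by move=> y x z /asboolP xy /asboolP yz; apply/asboolP; apply: rst_trans yz. Qed.
Canonical glue_equiv n :=
  EquivRel (@glueb n) (@glueb_refl n) (@glueb_sym n) (@glueb_trans n).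

Definition po n : Type := {eq_quot (glue_equiv n)}.

Definition po_class n (x : B n + C n) : po n :=
  \pi_({eq_quot (glue_equiv n)}) (x : {classic (B n + C n)%type}).
Definition po_repr n (q : po n) : B n + C n :=
  repr (q : {eq_quot (glue_equiv n)}).

Lemma po_reprK n (q : po n) : po_class (po_repr q) = q.
Proof. exact: reprK. Qed.

Lemma po_classP n (x y : B n + C n) : po_class x = po_class y <-> glue x y.
Proof.
split=> [/eqmodP/asboolP//|xy].
by apply/eqmodP; apply/asboolP.
Qed.

Definition sum_act m n (s : ord_map m n) (x : B n + C n) : B m + C m :=
  match x with inl b => inl (act s b) | inr c => inr (act s c) end.

Lemma sum_act_glue m n (s : ord_map m n) (x y : B n + C n) :
  glue x y -> glue (sum_act s x) (sum_act s y).
Proof.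
elim=> {x y} [_ _ [a [-> ->]]|x|x y _|x y z _ xy _].
- by apply: rst_step; exists (act s a); rewrite !app_act.
- exact: rst_refl.
- exact: rst_sym.
- exact: rst_trans xy.
Qed.

Definition po_act m n (s : ord_map m n) (q : po n) : po m :=
  po_class (sum_act s (po_repr q)).

Lemma po_actE m n (s : ord_map m n) (x : B n + C n) :
  po_act s (po_class x) = po_class (sum_act s x).
Proof. by apply/po_classP/sum_act_glue/po_classP; rewrite po_reprK. Qed.

Lemma po_act_id n (q : po n) : po_act (ord_id n) q = q.
Proof.
rewrite -[q]po_reprK po_actE; congr po_class.
by case: po_repr => x /=; rewrite act_id.
Qed.

Lemma po_act_comp l m n (s : ord_map m n) (t : ord_map l m) (q : po n) :
  po_act (ord_comp s t) q = po_act t (po_act s q).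
Proof.
rewrite -[q]po_reprK !po_actE; congr po_class.
by case: po_repr => x /=; rewrite act_comp.
Qed.

Definition pushout : sSet := SSet po_act_id po_act_comp.

Definition po_inl : sMap B pushout.
Proof.
by exists (fun n b => po_class (inl b) : pushout n) => m n s x /=; rewrite po_actE.
Defined.

Definition po_inr : sMap C pushout.
Proof.
by exists (fun n c => po_class (inr c) : pushout n) => m n s x /=; rewrite po_actE.
Defined.

Section Elim.
Variables (Z : sSet) (u : sMap B Z) (v : sMap C Z).
Hypothesis uv : forall n (a : A n), u n (f n a) = v n (g n a).

Definition sum_elim n (x : B n + C n) : Z n :=
  match x with inl b => u n b | inr c => v n c end.

Lemma sum_elim_glue n (x y : B n + C n) : glue x y -> sum_elim x = sum_elim y.
Proof.
by elim=> {x y} [_ _ [a [-> ->]]|x|x y _ ->|x y z _ -> _ ->] //=.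
Qed.

Lemma sum_elim_repr n (x : B n + C n) :
  sum_elim (po_repr (po_class x)) = sum_elim x.
Proof. by apply/sum_elim_glue/po_classP; rewrite po_reprK. Qed.

Definition po_elim : sMap pushout Z.
Proof.
exists (fun n (q : pushout n) => sum_elim (po_repr q)) => m n s q.
rewrite -[q]po_reprK [act _ _]po_actE !sum_elim_repr.
by case: po_repr => x /=; rewrite app_act.
Defined.

End Elim.

Lemma pushoutP : is_pushout (C := sSetCat) f g po_inr po_inl.
Proof.
split=> [|Z u v uv].
  by apply: sMap_eq => n a; apply/po_classP/rst_step; exists a.
have uv' n (a : A n) : u n (f n a) = v n (g n a).
  exact: (congr1 (fun h : sMap A Z => h n a) uv).
exists (po_elim uv'); split.
  by split; apply: sMap_eq => n x; apply: (sum_elim_repr uv').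
move=> w [wu wv]; apply: sMap_eq => n q; rewrite -[q]po_reprK.
rewrite [LHS](sum_elim_repr uv'); case: po_repr => x /=.
  by rewrite -wu.
by rewrite -wv.
Qed.

End Pushout.

(* collapse K  is  X ∐_K Δ^0. *)
Definition collapse (X : sSet) (K : subS X) : sSet :=
  pushout (incl K) (to_Delta0 (sub_sSet K)).

Definition to_collapse (X : sSet) (K : subS X) : sMap X (collapse K) :=
  po_inl (incl K) (to_Delta0 (sub_sSet K)).

(* The map  X ∐_{f^-1(K)} Δ^0 -> Y ∐_K Δ^0  induced by f : X -> Y. *)
Lemma collapse_map_subproof (X Y : sSet) (f : sMap X Y) (K : subS Y) n
    (x : sub_sSet (preim_subS f K) n) :
  sMap_comp (to_collapse K) f n (incl (preim_subS f K) n x) =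
  po_inr (incl K) (to_Delta0 (sub_sSet K)) n (to_Delta0 _ n x).
Proof. by apply/po_classP/rst_step; exists (preim_map f K n x). Qed.
Definition collapse_map (X Y : sSet) (f : sMap X Y) (K : subS Y) :
    sMap (collapse (preim_subS f K)) (collapse K) :=
  po_elim (@collapse_map_subproof X Y f K).

(* Λ^n_i ∐_{Δ^I} Δ^0 -> Δ^n ∐_{Δ^I} Δ^0.  It is only used when Δ^I lies in
   Λ^n_i, so that the preimage of Δ^I under the horn inclusion is Δ^I. *)
Definition collapsed_horn (n i : nat) (I : seq nat) :
    sMap (collapse (preim_subS (horn_incl n i) (face n I)))
         (collapse (face n I)) :=
  collapse_map (horn_incl n i) (face n I).

(* Q = Δ^0 ∐_{Δ^{0,2}} Δ^3 ∐_{Δ^{1,3}} Δ^0. *)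
Definition Q_attach : sMap (sub_sSet (face 3 [:: 1; 3]))
                           (collapse (face 3 [:: 0; 2])) :=
  sMap_comp (to_collapse (face 3 [:: 0; 2])) (incl (face 3 [:: 1; 3])).
Definition Qsset : sSet := pushout Q_attach (to_Delta0 _).
Definition to_Q : sMap (Delta 3) Qsset :=
  sMap_comp (po_inl Q_attach (to_Delta0 _)) (to_collapse (face 3 [:: 0; 2])).

Record scSet := ScSet {
  sc_sSet :> sSet;
  thin : sc_sSet 2 -> Prop;
  thin_degenerate : forall x : sc_sSet 2, degenerate x -> thin x }.

Arguments thin {_} x.

Record scMap (X Y : scSet) := ScMap {
  sc_map :> sMap X Y;
  sc_map_thin : forall x : X 2, thin x -> thin (sc_map 2 x) }.

Lemma scMap_eq (X Y : scSet) (f g : scMap X Y) :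
  sc_map f = sc_map g -> f = g.
Proof.
case: f g => [f f1] [g g1] /= E; case: _ / E in g1 *.
by congr ScMap; apply: Prop_irrelevance.
Qed.

Definition scMap_id (X : scSet) : scMap X X :=
  @ScMap X X (sMap_id X) (fun _ h => h).
Definition scMap_comp (X Y Z : scSet) (g : scMap Y Z) (f : scMap X Y) :
    scMap X Z :=
  @ScMap X Z (sMap_comp g f) (fun x h => sc_map_thin g (sc_map_thin f h)).

Definition scSetCat : category.
Proof.
by apply: (@Category scSet scMap scMap_id scMap_comp) => *;
  apply: scMap_eq; apply: sMap_eq.
Defined.

Definition noneP {U : Type} : U -> Prop := fun _ => False.
Definition allP {U : Type} : U -> Prop := fun _ => True.

(* (X, T): the thin triangles are those of T and the degenerate ones. *)
Definition scaled (X : sSet) (T : X 2 -> Prop) : scSet :=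
  @ScSet X (fun x => degenerate x \/ T x) (fun _ h => or_introl h).

(* (A, T_|A) -> (B, T). *)
Lemma sc_restrict_subproof (A B : sSet) (j : sMap A B) (T : B 2 -> Prop)
    (x : A 2) : degenerate x \/ T (j 2 x) -> degenerate (j 2 x) \/ T (j 2 x).
Proof. by case=> [/(degenerate_map j)|]; [left | right]. Qed.
Definition sc_restrict (A B : sSet) (j : sMap A B) (T : B 2 -> Prop) :
    scMap (scaled (fun x : A 2 => T (j 2 x))) (scaled T) :=
  @ScMap (scaled _) (scaled T) j (@sc_restrict_subproof A B j T).

(* (X, T) -> (X, T') for T contained in T'. *)
Lemma sc_widen_subproof (X : sSet) (T T' : X 2 -> Prop)
    (TT' : forall x, T x -> T' x) (x : X 2) :
  degenerate x \/ T x -> degenerate x \/ T' x.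
Proof. by case=> [|/TT']; [left | right]. Qed.
Definition sc_widen (X : sSet) (T T' : X 2 -> Prop)
    (TT' : forall x, T x -> T' x) : scMap (scaled T) (scaled T') :=
  @ScMap (scaled T) (scaled T') (sMap_id X) (sc_widen_subproof TT').

(* The set of m-simplices of Δ^n with vertex lists in l, and its image under a
   map out of Δ^n. *)
Definition simp_of n (l : seq (seq nat)) {m} : Delta n m -> Prop :=
  fun s => verts s \in l.
Definition image_of n (l : seq (seq nat)) (X : sSet) (q : sMap (Delta n) X)
    {m} : X m -> Prop :=
  fun x => exists2 s, simp_of l s & x = q m s.

Definition inner_scaling n i : Delta n 2 -> Prop :=
  simp_of [:: [:: i.-1; i; i.+1]].

Definition sc_inner_horn (n i : nat) := sc_restrict (horn_incl n i)
  (@inner_scaling n i).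

Definition saturation_T : seq (seq nat) :=
  [:: [:: 0; 2; 4]; [:: 1; 2; 3]; [:: 0; 1; 3]; [:: 1; 3; 4]; [:: 0; 1; 2]].
Definition saturation_T' : seq (seq nat) :=
  saturation_T ++ [:: [:: 0; 3; 4]; [:: 0; 1; 4]].

Lemma saturation_TT' (s : Delta 4 2) :
  simp_of saturation_T s -> simp_of saturation_T' s.
Proof. by rewrite /simp_of mem_cat => ->. Qed.
Definition sc_saturation := sc_widen saturation_TT'.

(* (Λ^n_i ∐_{Δ^I} Δ^0, {Δ^t}_|) -> (Δ^n ∐_{Δ^I} Δ^0, {Δ^t}).  The scaling is
   restricted along the map itself; since Δ^t is not contained in Δ^I, the
   result is the image of {Δ^t}_{|Λ^n_i}. *)
Definition sc_collapsed_horn (n i : nat) (I t : seq nat) :=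
  sc_restrict (collapsed_horn n i I)
    (image_of [:: t] (to_collapse (face n I))).

Definition infty_bicategory (B : scSet) : Prop :=
  [/\ forall n i, 0 < i < n ->
        has_extension (C := scSetCat) (sc_inner_horn n i) B,
      has_extension (C := scSetCat) sc_saturation B
    & forall n, 3 <= n ->
        has_extension (C := scSetCat)
          (sc_collapsed_horn n 0 [:: 0; 1] [:: 0; 1; n]) B].

Definition weak_fibration (X Y : scSet) (f : scMap X Y) : Prop :=
  [/\ forall n i, 0 < i < n ->
        has_lifting (C := scSetCat) (sc_inner_horn n i) f,
      forall n, 2 <= n ->
        has_lifting (C := scSetCat)
          (sc_collapsed_horn n 0 [:: 0; 1] [:: 0; 1; n]) f
    & forall n, 2 <= n ->
        has_lifting (C := scSetCat)
          (sc_collapsed_horn n n [:: n.-1; n] [:: 0; n.-1; n]) f].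

Definition detects_thin (X Y : scSet) (f : scMap X Y) : Prop :=
  forall x : X 2, thin x <-> thin (f 2 x).

Definition outer_fibration (X Y : scSet) (f : scMap X Y) : Prop :=
  [/\ weak_fibration f, detects_thin f,
      forall n, 2 <= n ->
        has_lifting (C := sSetCat) (collapsed_horn n 0 [:: 0; 1]) (sc_map f)
    & forall n, 2 <= n ->
        has_lifting (C := sSetCat) (collapsed_horn n n [:: n.-1; n])
          (sc_map f)].

Definition sc_right_horn (n : nat) := sc_restrict (horn_incl n n)
  (@simp_of n [:: [:: 0; n.-1; n]] 2).

Definition cartesian (X Y : scSet) (f : scMap X Y) (e : X 1) : Prop :=
  forall n, 2 <= n ->
  forall (u : scMap _ X) (v : scMap _ Y),
    scMap_comp f u = scMap_comp v (sc_right_horn n) ->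
    (forall s : Lambda n n 1, verts (sval s) = [:: n.-1; n] -> u 1 s = e) ->
    exists h : scMap _ X,
      scMap_comp h (sc_right_horn n) = u /\ scMap_comp f h = v.

Definition outer_cartesian_fibration (X Y : scSet) (f : scMap X Y) : Prop :=
  outer_fibration f /\
  forall (x : X 0) (e : Y 1), target e = f 0 x ->
    exists e' : X 1, [/\ f 1 e' = e, target e' = x & cartesian f e'].

Record msSet := MsSet {
  ms_scSet :> scSet;
  marked : ms_scSet 1 -> Prop;
  marked_degenerate : forall e : ms_scSet 1, degenerate e -> marked e }.

Arguments marked {_} e.

Record msMap (X Y : msSet) := MsMap {
  ms_map :> scMap X Y;
  ms_map_marked : forall e : X 1, marked e -> marked (ms_map 1 e) }.

Lemma msMap_eq (X Y : msSet) (f g : msMap X Y) :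
  ms_map f = ms_map g -> f = g.
Proof.
case: f g => [f f1] [g g1] /= E; case: _ / E in g1 *.
by congr MsMap; apply: Prop_irrelevance.
Qed.

Definition msMap_id (X : msSet) : msMap X X :=
  @MsMap X X (scMap_id X) (fun _ h => h).
Definition msMap_comp (X Y Z : msSet) (g : msMap Y Z) (f : msMap X Y) :
    msMap X Z :=
  @MsMap X Z (scMap_comp g f) (fun x h => ms_map_marked g (ms_map_marked f h)).

(* (X, E, T), degenerate edges and triangles being omitted from E and T. *)
Definition marked_scaled (X : sSet) (E : X 1 -> Prop) (T : X 2 -> Prop) :
    msSet :=
  @MsSet (scaled T) (fun e => degenerate e \/ E e) (fun _ h => or_introl h).

(* (A, E_|A, T_|A) -> (B, E, T). *)
Lemma ms_restrict_subproof (A B : sSet) (j : sMap A B) (E : B 1 -> Prop)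
    (e : A 1) : degenerate e \/ E (j 1 e) -> degenerate (j 1 e) \/ E (j 1 e).
Proof. by case=> [/(degenerate_map j)|]; [left | right]. Qed.
Definition ms_restrict (A B : sSet) (j : sMap A B)
    (E : B 1 -> Prop) (T : B 2 -> Prop) :
    msMap (marked_scaled (fun e : A 1 => E (j 1 e)) (fun x : A 2 => T (j 2 x)))
          (marked_scaled E T) :=
  @MsMap (marked_scaled _ _) (marked_scaled E T) (sc_restrict j T)
    (@ms_restrict_subproof A B j E).

(* (X, E, T) -> (X, E', T') for E, T contained in E', T'. *)
Lemma ms_widen_subproof (X : sSet) (E E' : X 1 -> Prop)
    (EE' : forall e, E e -> E' e) (e : X 1) :
  degenerate e \/ E e -> degenerate e \/ E' e.
Proof. by case=> [|/EE']; [left | right]. Qed.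
Definition ms_widen (X : sSet) (E E' : X 1 -> Prop) (T T' : X 2 -> Prop)
    (EE' : forall e, E e -> E' e) (TT' : forall x, T x -> T' x) :
    msMap (marked_scaled E T) (marked_scaled E' T') :=
  @MsMap (marked_scaled E T) (marked_scaled E' T') (sc_widen TT')
    (ms_widen_subproof EE').

Lemma none_sub (U : Type) (P : U -> Prop) (x : U) : noneP x -> P x.
Proof. by []. Qed.
Lemma sub_all (U : Type) (P : U -> Prop) (x : U) : P x -> allP x.
Proof. by []. Qed.

Record msOver (S : scSet) := MsOver {
  over_obj :> msSet;
  over_str : scMap over_obj S }.

Record overMap (S : scSet) (X Y : msOver S) := OverMap {
  over_map :> msMap X Y;
  over_map_str : scMap_comp (over_str Y) over_map = over_str X }.

Lemma overMap_eq (S : scSet) (X Y : msOver S) (f g : overMap X Y) :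
  over_map f = over_map g -> f = g.
Proof.
case: f g => [f f1] [g g1] /= E; case: _ / E in g1 *.
by congr OverMap; apply: Prop_irrelevance.
Qed.

Definition overMap_id (S : scSet) (X : msOver S) : overMap X X.
Proof.
by exists (msMap_id X); apply: scMap_eq; apply: sMap_eq.
Defined.

Definition overMap_comp (S : scSet) (X Y Z : msOver S)
  (g : overMap Y Z) (f : overMap X Y) : overMap X Z.
Proof.
exists (msMap_comp g f).
rewrite -(over_map_str f) -(over_map_str g).
by apply: scMap_eq; apply: sMap_eq.
Defined.

Definition msOverCat (S : scSet) : category.
Proof.
by apply: (@Category (msOver S) (@overMap S) (@overMap_id S)
                     (@overMap_comp S)) => *;
  apply: overMap_eq; apply: msMap_eq; apply: scMap_eq; apply: sMap_eq.
Defined.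

(* j : A -> B, regarded as a map over S by means of p : B -> S. *)
Definition over_gen (S : scSet) (A B : msSet) (j : msMap A B) (p : scMap B S) :
    overMap (MsOver (scMap_comp p j)) (MsOver p) :=
  @OverMap S (MsOver (scMap_comp p j)) (MsOver p) j erefl.

Definition ms_inner_horn (n i : nat) :=
  ms_restrict (horn_incl n i) noneP (@inner_scaling n i).

Definition ms_right_horn (n : nat) :=
  ms_restrict (horn_incl n n) (@simp_of n [:: [:: n.-1; n]] 1) noneP.

Definition ms_collapsed_horn (n : nat) :=
  ms_restrict (collapsed_horn n 0 [:: 0; 1]) noneP noneP.

Definition ms_thin_triangle :=
  @ms_widen (Delta 2) noneP noneP noneP (simp_of [:: [:: 0; 1; 2]])
    (@none_sub _ _) (@none_sub _ _).

Definition ms_Q :=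
  @ms_widen Qsset noneP (image_of [:: [:: 0; 1]; [:: 0; 3]] to_Q) allP allP
    (@none_sub _ _) (@sub_all _ _).

Definition ms_compose :=
  @ms_widen (Delta 2) (simp_of [:: [:: 0; 1]; [:: 1; 2]]) allP
    (simp_of [:: [:: 0; 1; 2]]) allP (@sub_all _ _) (@sub_all _ _).

Inductive anodyne_generator (S : scSet) :
    forall A B : msOverCat S, hom A B -> Prop :=
| Gen_inner n i p : 0 < i < n ->
    anodyne_generator (over_gen (S := S) (ms_inner_horn n i) p)
| Gen_right n p : 1 <= n ->
    anodyne_generator (over_gen (S := S) (ms_right_horn n) p)
| Gen_left n p : 2 <= n ->
    anodyne_generator (over_gen (S := S) (ms_collapsed_horn n) p)
| Gen_thin p : anodyne_generator (over_gen (S := S) ms_thin_triangle p)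
| Gen_Q p : anodyne_generator (over_gen (S := S) ms_Q p)
| Gen_compose p : anodyne_generator (over_gen (S := S) ms_compose p).

Definition outer_cartesian_anodyne (S : scSet) (A B : msOverCat S)
    (j : hom A B) : Prop :=
  saturation (@anodyne_generator S) j.

(* Main.v *)
From mathcomp Require Import all_boot.
From mathcomp Require Import boolp.
From mathcomp Require Import zify.
Require Import Defs.

Set Implicit Arguments.
Unset Strict Implicit.
Unset Printing Implicit Defensive.

Local Open Scope cat_scope.

(** Lifting against a saturated class is lifting against its generators, so the
    theorem compares the six families of generators with the notion of outer
    cartesian fibration.  Since f detects thin triangles, thinness in X can
    always be checked in the base.

    The difficulty is that a cartesian edge e only promises fillers of those
    right horns whose triangle {0, n-1, n} is thin, whereas the second family
    of generators has no such condition; call e strongly cartesian when all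
    right horns ending in e have fillers.  Degenerate edges are strongly
    cartesian in an outer fibration.  The key lemma
    (compose_strongly_cartesian) says that if a thin triangle a, b, c has a
    cartesian edge ab and a strongly cartesian edge bc, then ac is strongly
    cartesian.  Applied to the degenerate triangle e, id it shows that
    cartesian edges are strongly cartesian; applied to two cartesian edges it
    gives the sixth family of generators.  A variant for 3-simplices
    (equivalence_strongly_cartesian) gives the fifth: if all triangles of a
    3-simplex a, b, c, d are thin and ac, bd are strongly cartesian, so is ab.

    Both are proved by the same method (join_filler).  A right horn ending in
    ac consists of simplices which join faces of J = {0, ..., n-2} with a and
    c.  Glue the whole triangle to it.  The base is a scaled simplicial set
    with inner fillers, so there the result extends to the join of J with the
    triangle, in such a way that every {j, a, b} is thin.  Over this simplex
    of the base one extends in X: first to the join of the boundary of J with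
    the triangle (inner horns at a), next to J * {b, c} because bc is strongly
    cartesian, then to J * {a, b} because ab is cartesian and {0, a, b} is
    thin, and finally to everything by an inner horn at b, which is allowed as
    the triangle is thin.  The face J * {a, c} is the filler.  In the variant
    the faces containing a are reached from those without a by lifting along
    ac, and J * {a, b} is then obtained from J * {a, d} by lifting along bd.

    Each of these extensions adds a set of faces which is stable under adding
    and removing one vertex, the pivot; such a set is a succession of horns at
    the pivot (pivot_extend).

    Conversely, let X lift against the generators.  Marked edges are strongly
    cartesian, edges of the base have marked lifts, and it remains to see that
    a cartesian edge e is marked (cartesian_marked).  Compare it with a marked
    lift e' of its image: lifting over a degenerate simplex produces a
    4-simplex 0, 1, 2, 3, 4 with edges 04 and 24 equal to e, edges 14 and 34
    equal to e', and degenerate edges 02 and 13.  Hence 01 is marked by the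
    fifth family, being an equivalence, and e = 04 is marked by the sixth, as
    the composite of 01 and 14. *)

(** * Extension problems along saturated classes *)

Section Saturation.
Variables (C : category) (X : C).

Local Notation ext := (fun (A B : C) (j : hom A B) => has_extension j X).

Lemma extension_pushout : closed_pushout ext.
Proof.
move=> A B A' B' f g f' g' [_ univ] fX u.
have [h hf] := fX (u ∘ g).
by have [w [[_ wu] _]] := univ _ _ _ hf; exists w.
Qed.

Lemma extension_retract : closed_retract ext.
Proof.
move=> A B A' B' f g [i [r [i' [r' [ri _ gi fr]]]]] gX u.
have [h hg] := gX (u ∘ r).
by exists (h ∘ i'); rewrite -compA -gi compA hg -compA ri compm1.
Qed.

Lemma cocone_eq (A : C) (D : chain A) (P : idx D -> Prop) (L : C)
    (k k' : cocone P L) :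
  base k = base k' -> (forall i (Pi : P i), leg k Pi = leg k' Pi) -> k = k'.
Proof.
case: k k' => [b l lf ls] [b' l' lf' ls'] /= bb ll.
have E : l = l'.
  apply: functional_extensionality_dep => i.
  by apply: functional_extensionality_dep => Pi.
case: _ / bb in lf' *; case: _ / E in lf' ls' *.
by congr Cocone; apply: Prop_irrelevance.
Qed.

Section Transfinite.
Variables (A : C) (D : chain A) (u : hom A X).

Local Notation below i := (fun j => idx_lt j i).

Variable c : forall i : idx D, cocone (below i) X -> hom (ob i) X.
Hypothesis cP : forall i (k : cocone (below i) X),
  cocone_map (cocone_at i) k (c k).

(** The graph of the recursion which extends u to one stage of D after the
    other by means of the choice c.  It is a relation because the extension to
    a stage is only chosen for compatible extensions to the earlier ones. *)
Inductive stage : forall i : idx D, hom (ob i) X -> Prop :=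
| Stage i (k : cocone (below i) X) :
    base k = u -> (forall j (ji : idx_lt j i), stage (leg k ji)) ->
    stage (c k).

Lemma stage_inv i (h : hom (ob i) X) : stage h ->
  exists k : cocone (below i) X,
    [/\ base k = u, forall j (ji : idx_lt j i), stage (leg k ji) & h = c k].
Proof. by case=> i' k ku kj; exists k. Qed.

Lemma stage_unique i (h h' : hom (ob i) X) : stage h -> stage h' -> h = h'.
Proof.
elim/(well_founded_ind (@lt_wf _ _ D)): i h h' => i IH h h'.
case/stage_inv=> [k [ku kj ->]] /stage_inv[k' [k'u k'j ->]].
congr c; apply: cocone_eq => [|j ji]; first by rewrite ku k'u.
exact: IH (ji) _ _ (kj _ _) (k'j _ _).
Qed.

Lemma stage_from i (h : hom (ob i) X) : stage h -> h ∘ from i = u.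
Proof. by case/stage_inv=> k [<- _ ->]; have [] := cP k. Qed.

Lemma stage_step i j (ij : idx_lt i j) (h : hom (ob i) X) (h' : hom (ob j) X) :
  stage h -> stage h' -> h' ∘ step ij = h.
Proof.
move=> hi /stage_inv[k [ku kj ->]]; have [_ /(_ _ ij) -> ] := cP k.
exact: stage_unique (kj _ _) hi.
Qed.

Lemma stage_exists i : exists h : hom (ob i) X, stage h.
Proof.
elim/(well_founded_ind (@lt_wf _ _ D)): i => i IH.
pose l j (ji : idx_lt j i) := sval (cid (IH j ji)).
have lP j (ji : idx_lt j i) : stage (l j ji) by rewrite /l; case: cid.
have lf j (ji : idx_lt j i) : l j ji ∘ from j = u by apply: stage_from.
have ls j j' (ji : idx_lt j i) (j'i : idx_lt j' i) (jj' : idx_lt j j') :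
  l j' j'i ∘ step jj' = l j ji by apply: stage_step.
by exists (c (Cocone lf ls)); apply: Stage.
Qed.

End Transfinite.

Lemma extension_transfinite : closed_transfinite ext.
Proof.
move=> A D DX L k colim u.
have ex (i : idx D) (k' : cocone (fun j => idx_lt j i) X) :
    exists h : hom (ob i) X, cocone_map (cocone_at i) k' h.
  have [L' [l [t [l_colim [tb tl] tX]]]] := DX i.
  have [w [[wb wl] _]] := l_colim _ k'; have [h ht] := tX w.
  exists h; split=> [|j ji] /=; first by rewrite -[from i]tb compA ht wb.
  by rewrite -[step ji](tl j ji) compA ht wl.
pose c i k' := sval (cid (ex i k')).
have cP i k' : cocone_map (cocone_at i) k' (c i k') by rewrite /c; case: cid.
pose h i := sval (cid (stage_exists u cP i)).
have hP i : stage u c (h i) by rewrite /h; case: cid.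
have hf i (_ : True) : h i ∘ from i = u by apply: stage_from (hP i).
have hs i j (_ _ : True) (ij : idx_lt i j) : h j ∘ step ij = h i.
  by apply: stage_step (hP i) (hP j).
have [w [[wb _] _]] := colim _ (Cocone hf hs).
by exists w.
Qed.

Lemma extension_saturated : weakly_saturated ext.
Proof.
by split; [apply: extension_pushout | apply: extension_transfinite
          | apply: extension_retract].
Qed.

End Saturation.

Lemma anodyne_extension (S : scSet) (X : msOverCat S) :
  (forall (A A' : msOverCat S) (j : hom A A'),
     outer_cartesian_anodyne j -> has_extension j X) <->
  (forall (A A' : msOverCat S) (j : hom A A'),
     anodyne_generator j -> has_extension j X).
Proof.
split=> H A A' j; first by move=> jG; apply: H => W _; apply.
by move=> /(_ _ (extension_saturated X) H).
Qed.

(** * Simplices of the standard simplex and their vertices *)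

Definition supp m n (s : ord_map m n) : {set 'I_n.+1} := [set s i | i : 'I_m.+1].

Lemma suppP m n (s : ord_map m n) x :
  reflect (exists i, x = s i) (x \in supp s).
Proof.
apply: (iffP imsetP) => [[i _ ->]|[i ->]]; first by exists i.
by exists i.
Qed.

Lemma mem_supp m n (s : ord_map m n) i : s i \in supp s.
Proof. exact: imset_f. Qed.

Lemma ord_compE l m n (s : ord_map m n) (t : ord_map l m) i :
  ord_comp s t i = s (t i).
Proof. by rewrite ffunE. Qed.

Lemma supp_comp l m n (s : ord_map m n) (t : ord_map l m) :
  supp (ord_comp s t) = s @: supp t.
Proof.
by rewrite /supp -imset_comp; apply: eq_imset => i /=; rewrite ord_compE.
Qed.

Lemma supp_comp_sub l m n (s : ord_map m n) (t : ord_map l m) :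
  supp (ord_comp s t) \subset supp s.
Proof. by apply/subsetP => x /suppP[i ->]; rewrite ord_compE mem_supp. Qed.

Lemma ord_map_lt m n (s : ord_map m n) : injective s ->
  forall i j, (s i < s j) = (i < j).
Proof.
move=> s_inj i j; case: (ltngtP i j) => [ij|ji|/val_inj->]; rewrite ?ltnn //.
  rewrite ltn_neqAle ord_mapP ?(ltnW ij) // andbT.
  by apply/eqP => /val_inj/s_inj E; rewrite E ltnn in ij.
by apply/negbTE; rewrite -leqNgt ord_mapP // ltnW.
Qed.

Lemma ord_map_le m n (s : ord_map m n) : injective s ->
  forall i j, (s i <= s j) = (i <= j).
Proof. by move=> s_inj i j; rewrite leqNgt ord_map_lt // -leqNgt. Qed.

Lemma ord_comp_inj l m n (s : ord_map m n) (t t' : ord_map l m) :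
  injective s -> ord_comp s t = ord_comp s t' -> t = t'.
Proof.
move=> s_inj tt'; apply: ord_map_eq => i; apply: s_inj.
by rewrite -!ord_compE tt'.
Qed.

Lemma ord_factor l m n (s : ord_map m n) (r : ord_map l n) :
  injective s -> supp r \subset supp s -> exists t, r = ord_comp s t.
Proof.
move=> s_inj /subsetP rs.
have ex i : exists j, s j == r i.
  by have /suppP[j ->] := rs _ (mem_supp r i); exists j.
pose t i := xchoose (ex i).
have tE i : s (t i) = r i by apply/eqP/(xchooseP (ex i)).
have t_mono : monotone [ffun i => t i].
  apply/forallP=> i; apply/forallP=> j; apply/implyP=> ij.
  by rewrite !ffunE -(ord_map_le s_inj) !tE ord_mapP.
by exists (OrdMap t_mono); apply: ord_map_eq => i; rewrite ord_compE /= ffunE tE.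
Qed.

(** The default value is used unless g 0, ..., g m are weakly increasing; so g
    can be given without a proof of monotonicity. *)
Definition omap m n (g : nat -> nat) : ord_map m n :=
  insubd (ord_const m ord0) [ffun i : 'I_m.+1 => inord (g i)].

Lemma omapE m n (g : nat -> nat) (i : 'I_m.+1) :
  (forall i, i <= m -> g i <= n) ->
  (forall i j, i <= j <= m -> g i <= g j) -> omap m n g i = g i :> nat.
Proof.
move=> gn g_mono.
have gE (j : 'I_m.+1) : (inord (g j) : 'I_n.+1) = g j :> nat.
  by rewrite inordK // ltnS gn // -ltnS.
have -> : omap m n g = [ffun i : 'I_m.+1 => inord (g i)] :> {ffun _ -> _}.
  rewrite /omap -[LHS]/(val _) val_insubd ifT //.
  apply/forallP=> j; apply/forallP=> k; apply/implyP=> jk.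
  by rewrite !ffunE !gE g_mono // jk -ltnS ltn_ord.
by rewrite ffunE gE.
Qed.

Lemma face_exists n (S : {set 'I_n.+1}) : S != set0 ->
  exists m (s : ord_map m n), injective s /\ supp s = S.
Proof.
move=> S0; pose l := enum S.
have l_sort : sorted (relpre val ltn) l.
  rewrite /l /enum_mem -enumT; apply: sorted_filter.
    by move=> x y z /=; apply: ltn_trans.
  by rewrite -(@sorted_map _ _ val ltn) val_enum_ord iota_ltn_sorted.
have [m lE] : exists m, size l = m.+1.
  by exists #|S|.-1; rewrite -cardE prednK // card_gt0.
pose t (i : 'I_m.+1) := nth ord0 l i.
have t_lt (i j : 'I_m.+1) : i < j -> t i < t j.
  move=> ij; apply: (sorted_ltn_nth _ ord0 l_sort) => //.
  - by move=> x y z /=; apply: ltn_trans.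
  - by rewrite inE lE.
  - by rewrite inE lE.
have t_mono : monotone [ffun i => t i].
  apply/forallP=> i; apply/forallP=> j; apply/implyP; rewrite !ffunE leq_eqVlt.
  by case/predU1P=> [/val_inj->//|/t_lt/ltnW].
exists m, (OrdMap t_mono); split=> [i j|].
  rewrite /= !ffunE => tij; apply: val_inj.
  by case: (ltngtP i j) => // /t_lt; rewrite tij ltnn.
apply/setP=> x; apply/suppP/idP => [[i ->]|xS].
  by rewrite /= ffunE -mem_enum mem_nth // lE.
rewrite -mem_enum in xS.
have xl : index x l < m.+1 by rewrite -lE index_mem.
by exists (Ordinal xl); rewrite /= ffunE /t nth_index.
Qed.

(** * Gluing simplices along subcomplexes of the standard simplex *)

(** A partial map from the standard simplex to X, the domain being given
    separately as a family of faces: values outside the domain are irrelevant,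
    which avoids maps out of subtypes while the domain grows. *)
Definition pmap (M : nat) (X : sSet) := forall m, ord_map m M -> X m.

(** Subcomplexes of the standard simplex are encoded by the vertex sets of
    their faces. *)
Definition complex M (K : {set {set 'I_M.+1}}) : Prop :=
  forall S T : {set 'I_M.+1}, S \in K -> T \subset S -> T \in K.

Definition simplicial_on M X (K : {set {set 'I_M.+1}}) (u : pmap M X) : Prop :=
  forall m l (s : ord_map m M) (t : ord_map l m),
    supp s \in K -> u l (ord_comp s t) = act t (u m s).

Definition agree_on M X (K : {set {set 'I_M.+1}}) (u w : pmap M X) : Prop :=
  forall m (s : ord_map m M), supp s \in K -> u m s = w m s.

Definition represent M (X : sSet) (x : X M) : pmap M X := fun m s => act s x.

Definition retraction N M (d : ord_map N M) m (s : ord_map m M) : ord_map m N :=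
  odflt (ord_const m ord0) [pick t | ord_comp d t == s].

Lemma retractionK N M (d : ord_map N M) m (t : ord_map m N) :
  injective d -> retraction d (ord_comp d t) = t.
Proof.
move=> d_inj; rewrite /retraction; case: pickP => [t' /eqP/(ord_comp_inj d_inj)//|].
by move/(_ t); rewrite eqxx.
Qed.

Definition push_complex N M (d : ord_map N M) (K : {set {set 'I_N.+1}}) :
    {set {set 'I_M.+1}} :=
  [set S : {set 'I_M.+1} | (S \subset supp d) && (d @^-1: S \in K)].

Lemma preimset_supp N M (d : ord_map N M) m (t : ord_map m N) :
  injective d -> d @^-1: supp (ord_comp d t) = supp t.
Proof.
move=> d_inj; apply/setP=> x; rewrite supp_comp inE.
by rewrite mem_imset.
Qed.

Lemma push_complexP N M (d : ord_map N M) (K : {set {set 'I_N.+1}}) m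
    (t : ord_map m N) : injective d ->
  (supp (ord_comp d t) \in push_complex d K) = (supp t \in K).
Proof. by move=> d_inj; rewrite inE supp_comp_sub preimset_supp. Qed.

Lemma complex_push N M (d : ord_map N M) K :
  complex K -> complex (push_complex d K).
Proof.
move=> Kdown S T; rewrite !inE => /andP[Sd SK] TS.
by rewrite (subset_trans TS Sd) (Kdown _ _ SK) // preimsetS.
Qed.

Lemma complexU M (K K' : {set {set 'I_M.+1}}) :
  complex K -> complex K' -> complex (K :|: K').
Proof.
move=> Kd K'd S T; rewrite !inE => /orP[SK|SK'] TS; first by rewrite (Kd _ _ SK).
by rewrite (K'd _ _ SK') ?orbT.
Qed.

Lemma complex_powerset M (S : {set 'I_M.+1}) : complex (powerset S).
Proof. by move=> T U; rewrite !powersetE => TS UT; apply: subset_trans TS. Qed.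

Lemma push_simplicial N M (d : ord_map N M) (X : sSet)
    (K : {set {set 'I_N.+1}}) (w : pmap N X) :
  injective d -> simplicial_on K w ->
  simplicial_on (push_complex d K) (fun m s => w m (retraction d s)).
Proof.
move=> d_inj wK m l s t; rewrite inE => /andP[sd sK].
have [r E] := ord_factor d_inj sd; rewrite {s sd}E -ord_compA in sK *.
by rewrite !retractionK // wK // -(preimset_supp _ d_inj).
Qed.

Lemma glue M (X : sSet) (K : {set {set 'I_M.+1}}) (u : pmap M X) N
    (d : ord_map N M) (x : X N) :
  complex K -> simplicial_on K u -> injective d ->
  (forall m (t : ord_map m N), supp (ord_comp d t) \in K ->
     u m (ord_comp d t) = act t x) ->
  exists u' : pmap M X,
    [/\ simplicial_on (K :|: powerset (supp d)) u', agree_on K u' u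
      & forall m (t : ord_map m N), u' m (ord_comp d t) = act t x].
Proof.
move=> Kd uK d_inj ux.
pose u' m (s : ord_map m M) :=
  if supp s \in K then u m s else act (retraction d s) x.
have u'd m (t : ord_map m N) : u' m (ord_comp d t) = act t x.
  by rewrite /u'; case: ifP => [/ux//|_]; rewrite retractionK.
exists u'; split=> // [m l s t|m s sK]; last by rewrite /u' sK.
rewrite !inE; case: (boolP (supp s \in K)) => /= [sK _|_ sd].
  by rewrite /u' sK (Kd _ _ sK) ?supp_comp_sub // uK.
have [r ->] := ord_factor d_inj sd.
by rewrite -ord_compA !u'd act_comp.
Qed.

(** The common face of d and e is the one spanned by d' in d and by e' in e;
    compatibility on it is a single equation between simplices. *)
Lemma glue_along M (X : sSet) N (d : ord_map N M) (K : {set {set 'I_N.+1}})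
    (w : pmap N X) L (e : ord_map L M) (x : X L) r (d' : ord_map r N)
    (e' : ord_map r L) :
  complex K -> simplicial_on K w -> injective d -> injective e ->
  ord_comp d d' = ord_comp e e' ->
  supp d :&: supp e \subset supp (ord_comp e e') ->
  injective e' -> supp d' \in K -> w r d' = act e' x ->
  exists u : pmap M X,
    [/\ simplicial_on (push_complex d K :|: powerset (supp e)) u,
        forall m (t : ord_map m N), supp t \in K -> u m (ord_comp d t) = w m t
      & forall m (t : ord_map m L), u m (ord_comp e t) = act t x].
Proof.
move=> Kd wK d_inj e_inj de inter e'_inj d'K wx.
have [m t tK|u' [u'K u'd u'e]] := glue (complex_push (d := d) Kd)
    (push_simplicial d_inj wK) e_inj (x := x).
  have td : supp (ord_comp e t) \subset supp d.
    by move: tK; rewrite inE => /andP[].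
  have : supp (ord_comp e t) \subset supp (ord_comp e e').
    by apply: subset_trans inter; rewrite subsetI td supp_comp_sub.
  case/ord_factor=> [i j|q E].
    by rewrite !ord_compE => /e_inj/e'_inj.
  have {}E : t = ord_comp e' q by apply: (ord_comp_inj e_inj); rewrite ord_compA.
  by rewrite E ord_compA -de -ord_compA retractionK // wK // wx act_comp.
exists u'; split=> // m t tK; rewrite u'd ?push_complexP //.
by rewrite retractionK.
Qed.

(** * Extending partial maps along pivots *)

Definition hornc N (i : 'I_N.+1) : {set {set 'I_N.+1}} :=
  [set S : {set 'I_N.+1} | ~~ ([set~ i] \subset S)].

Lemma horncP N (i : 'I_N.+1) (S : {set 'I_N.+1}) :
  reflect (exists j, j != i /\ j \notin S) (S \in hornc i).
Proof.
rewrite inE; apply: (iffP subsetPn) => [[j]|[j [ji jS]]].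
  by rewrite !inE => ji jS; exists j.
by exists j; rewrite // !inE.
Qed.

Lemma complex_hornc N (i : 'I_N.+1) : complex (hornc i).
Proof.
move=> S T; rewrite !inE => SK TS; apply: contra SK => iT.
exact: subset_trans TS.
Qed.

(** Take an added face S without P of least dimension.  A face of P |: S which
    lacks a vertex of S lies in K, as removing P from it would otherwise give
    a smaller added face without P; so the horn at P of P |: S lies in K.
    Fill it and repeat.  The invariant G records what the fillers have to
    respect, such as lying over a given simplex. *)
Lemma pivot_extend M (X : sSet) (K K' : {set {set 'I_M.+1}}) (P : 'I_M.+1)
    (G : forall k, ord_map k M -> X k -> Prop) (u : pmap M X) :
  complex K -> complex K' -> K \subset K' ->
  (forall S, S \in K' -> S \notin K -> P |: S \in K' /\ S :\ P \notin K) ->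
  (forall N (d : ord_map N M) (i : 'I_N.+1) (w : pmap N X),
     injective d -> d i = P -> supp d \in K' -> supp d \notin K ->
     (forall k (t : ord_map k N), supp (ord_comp d t) \in K ->
        supp t \in hornc i) ->
     simplicial_on (hornc i) w ->
     (forall k (t : ord_map k N), supp t \in hornc i -> G k (ord_comp d t) (w k t)) ->
     exists x : X N, agree_on (hornc i) (represent x) w /\
       forall k (t : ord_map k N), G k (ord_comp d t) (act t x)) ->
  simplicial_on K u ->
  (forall k (s : ord_map k M), supp s \in K -> G k s (u k s)) ->
  exists u' : pmap M X,
    [/\ simplicial_on K' u', agree_on K u' u
      & forall k (s : ord_map k M), supp s \in K' -> G k s (u' k s)].
Proof.
move=> + K'd; move En: #|K' :\: K| => n.
elim: n {-2}n (leqnn n) K u En => [|n IH] n' n'n K u En Kd KK' toggle fill uK uG.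
  exists u; have <- : K = K'.
    apply/eqP; rewrite eqEsubset KK' -setD_eq0 -cards_eq0 En.
    by move: n'n; rewrite leqn0.
  by split.
case: (set_0Vmem (K' :\: K)) => [K'K|[S0]].
  exists u; have <- : K = K' by apply/eqP; rewrite eqEsubset KK' -setD_eq0 K'K eqxx.
  by split.
rewrite inE => /andP[S0K S0K'].
pose A := [pred S : {set 'I_M.+1} | [&& S \in K', S \notin K & P \notin S]].
have A0 : A (S0 :\ P).
  rewrite /= (proj2 (toggle _ S0K' S0K)) (K'd _ _ S0K') ?subsetDl //.
  by rewrite !inE eqxx.
case: (@arg_minnP _ (S0 :\ P) A (fun S => #|S|) A0) => S /and3P[SK' SK PS] Smin.
have PSK' : P |: S \in K' by have [] := toggle _ SK' SK.
have PSK : P |: S \notin K.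
  by apply: contra SK => /Kd; apply; apply: subsetUr.
have [|N [d [d_inj dS]]] := @face_exists _ (P |: S).
  by apply/set0Pn; exists P; rewrite !inE eqxx.
have /suppP[i di] : P \in supp d by rewrite dS !inE eqxx.
(* By minimality of S, K contains the whole horn at P of the face P |: S. *)
have preim (T : {set 'I_N.+1}) : (d @: T \in K) = (T \in hornc i).
  apply/idP/idP => [dTK|/horncP[j [ji jT]]].
    rewrite inE; apply: contra SK => iT; apply: Kd dTK _.
    apply/subsetP=> x xS; have : x \in supp d by rewrite dS !inE xS orbT.
    case/suppP=> j xj; rewrite xj imset_f //; apply: (subsetP iT).
    by rewrite !inE; apply: contraNneq PS => ij; rewrite di -ij -xj.
  have djP : d j != P by rewrite di (inj_eq d_inj).
  have djS : d j \in S.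
    by have := mem_supp d j; rewrite dS !inE (negbTE djP).
  have sub : d @: T \subset P |: (S :\ d j).
    apply/subsetP=> _ /imsetP[k kT ->].
    have := mem_supp d k; rewrite dS !inE (inj_eq d_inj) => /orP[->//|->].
    by rewrite andbT; apply/orP; right; apply: contraNneq jT => <-.
  apply: contraT => dTK.
  have K1 : P |: (S :\ d j) \notin K by apply: contra dTK => /Kd; apply.
  have K'1 : P |: (S :\ d j) \in K'.
    by apply: K'd PSK' _; rewrite setUS // subsetDl.
  have : A (S :\ d j).
    rewrite /= (K'd _ _ SK') ?subsetDl // !inE negb_and PS orbT andbT.
    have [_] := toggle _ K'1 K1; apply: contra; rewrite setU1K //.
    by rewrite !inE negb_and PS orbT.
  by move/Smin; rewrite (cardsD1 (d j) S) djS add1n ltnn.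
pose w k (t : ord_map k N) := u k (ord_comp d t).
have [||k t|m l s t sK|k t tK|x [xw xG]] := fill N d i w d_inj (esym di); rewrite ?dS //.
- by rewrite supp_comp preim.
- by rewrite /w ord_compA uK // supp_comp preim.
- by apply: uG; rewrite supp_comp preim.
have [m t|u1 [u1K u1u u1x]] := glue (x := x) Kd uK d_inj.
  by rewrite supp_comp preim => tK; rewrite -[RHS]/(represent x t) xw.
pose K1 := K :|: powerset (P |: S); rewrite dS -/K1 in u1K.
have K1d : complex K1 by apply: complexU (@complex_powerset _ _).
have K1G k (s : ord_map k M) : supp s \in K1 -> G k s (u1 k s).
  rewrite !inE; case: (boolP (supp s \in K)) => /= [sK _|_].
    by rewrite u1u //; apply: uG.
  by rewrite -dS => /(ord_factor d_inj)[t ->]; rewrite u1x.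
have K1K' : K1 \subset K'.
  rewrite subUset KK' /=; apply/subsetP=> T; rewrite powersetE; exact: K'd.
have KK1 : K \subset K1 by apply: subsetUl.
have notK T : T \notin K1 -> T \notin K.
  by apply: contra => TK; apply: (subsetP KK1).
have card : #|K' :\: K1| <= n.
  rewrite -ltnS; apply: leq_trans n'n; rewrite -En; apply: proper_card.
  apply/properP; split; first by apply: setDS.
  exists (P |: S); first by rewrite inE PSK PSK'.
  by rewrite !inE subxx orbT.
have [T TK' TK1|N' d' i' w' ? ? ? /notK ? H|u' [u'K' u'u u'G]] :=
  IH _ card K1 u1 erefl K1d K1K' _ _ u1K K1G; last first.
- exists u'; split=> // m s sK.
  by rewrite u'u ?u1u // (subsetP KK1).
- by apply: fill => // k t /(subsetP KK1); apply: H.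
have [PTK' TPK] := toggle _ TK' (notK _ TK1); split=> //.
rewrite !inE negb_or TPK /=; apply: contra TK1 => TS; rewrite !inE; apply/orP; right.
by apply/subsetP=> y yT; have := subsetP TS y; rewrite !inE yT; case: eqP => //= _ ->.
Qed.

(** * Lifting properties in terms of horns of simplices *)

Lemma vertsE m n (s : ord_map m n) :
  verts s = mkseq (fun k => s (inord k) : nat) m.+1.
Proof.
rewrite /verts /mkseq -val_enum_ord -map_comp; apply: eq_map => i /=.
by rewrite inord_val.
Qed.

Lemma verts_edge n (s : ord_map 1 n) :
  verts s = [:: s (inord 0) : nat; s (inord 1) : nat].
Proof. exact: vertsE. Qed.

Lemma verts_triangle n (s : ord_map 2 n) :
  verts s = [:: s (inord 0) : nat; s (inord 1) : nat; s (inord 2) : nat].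
Proof. exact: vertsE. Qed.

Lemma mem_verts m n (s : ord_map m n) (x : 'I_n.+1) :
  (val x \in verts s) = (x \in supp s).
Proof.
apply/mapP/suppP => [[i _ /val_inj->]|[i ->]]; first by exists i.
by exists i; rewrite ?mem_enum.
Qed.

Lemma hornE N (i : 'I_N.+1) m (s : Delta N m) :
  horn N i m s <-> supp s \in hornc i.
Proof.
split=> [[j [jN ji js]]|/horncP[j [ji js]]].
  apply/horncP; have jN' : j < N.+1 by [].
  by exists (Ordinal jN'); rewrite -mem_verts.
by exists j; split; rewrite ?mem_verts // -ltnS.
Qed.

Definition yoneda (X : sSet) n (x : X n) : sMap (Delta n) X :=
  @SMap (Delta n) X (fun m s => act s x) (fun l m s t => act_comp t s x).

Lemma yonedaE (X : sSet) n (h : sMap (Delta n) X) m (s : Delta n m) :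
  h m s = act s (h n (ord_id n)).
Proof. by rewrite -app_act /= ord_comp_id. Qed.

Lemma sMap_app (X Y : sSet) (g h : sMap X Y) :
  g = h -> forall m (x : X m), g m x = h m x.
Proof. by move->. Qed.

Lemma scMap_app (X Y : scSet) (g h : scMap X Y) :
  g = h -> forall m (x : X m), g m x = h m x.
Proof. by move->. Qed.

Lemma ord_map0 m (s t : ord_map m 0) : s = t.
Proof. by apply: ord_map_eq => i; rewrite !ord1. Qed.

Section HornMap.
Variables (X : sSet) (N : nat) (i : 'I_N.+1) (w : pmap N X).
Hypothesis wH : simplicial_on (hornc i) w.

Lemma horn_map_subproof l m (t : ord_map l m) (s : Lambda N i m) :
  w (sval (act t s)) = act t (w (sval s)).
Proof. by apply: wH; apply/hornE; exact: svalP s. Qed.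

Definition horn_map : sMap (Lambda N i) X :=
  @SMap (Lambda N i) X (fun m s => w (sval s)) (fun l m t => @horn_map_subproof l m t).

End HornMap.

Lemma scaled_map_subproof (A : sSet) (T : A 2 -> Prop) (Z : scSet)
    (g : sMap A Z) (gT : forall x, T x -> thin (g 2 x)) (x : A 2) :
  degenerate x \/ T x -> thin (g 2 x).
Proof. by case=> [/(degenerate_map g)/thin_degenerate|/gT]. Qed.

Definition scaled_map (A : sSet) (T : A 2 -> Prop) (Z : scSet)
    (g : sMap A Z) (gT : forall x, T x -> thin (g 2 x)) : scMap (scaled T) Z :=
  @ScMap (scaled T) Z g (scaled_map_subproof gT).

Definition horn_over (X Y : sSet) (f : sMap X Y) N (i : 'I_N.+1)
    (w : pmap N X) (y : Y N) : Prop :=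
  simplicial_on (hornc i) w /\
  forall m (s : ord_map m N), supp s \in hornc i -> f m (w m s) = act s y.

Definition filler (X Y : sSet) (f : sMap X Y) N (i : 'I_N.+1)
    (w : pmap N X) (y : Y N) : Prop :=
  exists x : X N, f N x = y /\ agree_on (hornc i) (represent x) w.

Definition thin_on (Y : scSet) N (T : Delta N 2 -> Prop) (y : Y N) : Prop :=
  forall s, T s -> thin (act s y).

Section ScaledHorn.
Variables (X Y : scSet) (f : scMap X Y) (N : nat) (i : 'I_N.+1).
Variables (T : Delta N 2 -> Prop) (w : pmap N X) (y : Y N).
Hypotheses (f_thin : detects_thin f) (wy : horn_over f i w y) (yT : thin_on T y).

Lemma horn_square : exists (u : scMap (scaled (fun s => T (horn_incl N i 2 s))) X)
    (v : scMap (scaled T) Y),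
  [/\ scMap_comp f u = scMap_comp v (sc_restrict (horn_incl N i) T),
      forall m s, u m s = w (sval s) & v N (ord_id N) = y].
Proof.
have [wH wf] := wy.
have wT (s : Lambda N i 2) : T (sval s) -> thin (horn_map wH 2 s).
  by move=> sT; apply/f_thin; rewrite /= wf; [apply: yT | apply/hornE/svalP].
exists (scaled_map wT), (@scaled_map _ T Y (yoneda y) yT).
split=> //; last by rewrite /= act_id.
apply: scMap_eq; apply: sMap_eq => m s /=; apply: wf.
by apply/hornE/svalP.
Qed.

Lemma square_filler (u : scMap (scaled (fun s => T (horn_incl N i 2 s))) X)
    (v : scMap (scaled T) Y) (h : scMap (scaled T) X) :
  (forall m s, u m s = w (sval s)) -> v N (ord_id N) = y ->
  scMap_comp h (sc_restrict (horn_incl N i) T) = u -> scMap_comp f h = v ->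
  filler f i w y.
Proof.
move=> uw vy hu hv; exists (h N (ord_id N)); split.
  by rewrite -vy -hv.
move=> m s sH; have sH' : horn N i m s by apply/hornE.
rewrite -[RHS](uw m (exist _ s sH')) -hu /= /represent.
by rewrite -(yonedaE h).
Qed.

End ScaledHorn.

Definition consecutive N (i : 'I_N.+1) (s : ord_map 2 N) : Prop :=
  [/\ (s (inord 0)).+1 = i, s (inord 1) = i & s (inord 2) = i.+1 :> nat].

Lemma inner_scalingE N (i : 'I_N.+1) (s : ord_map 2 N) : 0 < i ->
  @inner_scaling N i s <-> consecutive i s.
Proof.
move=> i0; rewrite /inner_scaling /simp_of inE verts_triangle; split.
  case/eqP=> s0 s1 s2; split=> //; first by rewrite s0 prednK.
  exact: val_inj.
by case=> s0 s1 s2; rewrite s1 s2 -s0 eqxx.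
Qed.

Lemma inner_filler (X Y : scSet) (f : scMap X Y) N (i : 'I_N.+1)
    (w : pmap N X) (y : Y N) :
  detects_thin f -> 0 < i < N -> has_lifting (C := scSetCat) (sc_inner_horn N i) f ->
  horn_over f i w y -> thin_on (consecutive i) y -> filler f i w y.
Proof.
move=> f_thin /andP[i0 iN] f_lift wy y_thin.
have yT : thin_on (@inner_scaling N i) y.
  by move=> s /(inner_scalingE s i0); apply: y_thin.
have [u [v [uv uw vy]]] := horn_square f_thin wy yT.
have [h [hu hv]] := f_lift _ _ uv.
exact: square_filler uw vy hu hv.
Qed.

Lemma inner_extension (Y : scSet) N (i : 'I_N.+1) (w : pmap N Y) :
  0 < i < N -> has_extension (C := scSetCat) (sc_inner_horn N i) Y ->
  simplicial_on (hornc i) w ->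
  (forall s : ord_map 2 N, consecutive i s -> supp s \in hornc i ->
     thin (w 2 s)) ->
  exists2 y : Y N, agree_on (hornc i) (represent y) w & thin_on (consecutive i) y.
Proof.
move=> /andP[i0 iN] Y_ext wH w_thin.
have wT (s : Lambda N i 2) : @inner_scaling N i (sval s) -> thin (horn_map wH 2 s).
  move=> /(inner_scalingE (sval s) i0) sT; apply: w_thin => //.
  by apply/hornE/svalP.
have [h hw] := Y_ext (scaled_map wT).
exists (h N (ord_id N)) => [m s sH|s sT].
  have sH' : horn N i m s by apply/hornE.
  rewrite -[RHS]/(scaled_map wT m (exist _ s sH')) -hw /= /represent.
  by rewrite -(yonedaE h).
rewrite -(yonedaE h); apply: (@sc_map_thin (scaled _) _ h); right.
exact/inner_scalingE.
Qed.

(** ** Fillers of right horns *)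

(** The condition C on the base simplex makes room for both versions of
    cartesian edges: C is the thinness of {0, N-1, N} for cartesian edges, and
    no condition for strongly cartesian ones. *)
Definition right_fills (X Y : scSet) (f : scMap X Y)
    (C : forall N, Y N -> Prop) (e : X 1) : Prop :=
  forall N (w : pmap N X) (y : Y N), 2 <= N -> horn_over f ord_max w y ->
    (forall s : ord_map 1 N, verts s = [:: N.-1; N] -> w 1 s = e) ->
    C N y -> filler f ord_max w y.

Definition thin_last (Y : scSet) N (y : Y N) : Prop :=
  thin_on (fun s : ord_map 2 N => verts s = [:: 0; N.-1; N]) y.

Definition strongly_cartesian (X Y : scSet) (f : scMap X Y) (e : X 1) : Prop :=
  right_fills f (fun _ _ => True) e.

Lemma strongly_cartesian_fills (X Y : scSet) (f : scMap X Y)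
    (C : forall N, Y N -> Prop) (e : X 1) :
  strongly_cartesian f e -> right_fills f C e.
Proof. by move=> eC N w y N2 wy we _; apply: eC. Qed.

Lemma cartesian_fills (X Y : scSet) (f : scMap X Y) (e : X 1) :
  detects_thin f -> cartesian f e -> right_fills f (@thin_last Y) e.
Proof.
move=> f_thin eC N w y N2 wy we y_thin.
have yT : thin_on (@simp_of N [:: [:: 0; N.-1; N]] 2) y.
  by move=> s; rewrite /simp_of inE => /eqP; apply: y_thin.
have [u [v [uv uw vy]]] := horn_square (i := ord_max) f_thin wy yT.
have [|h [hu hv]] := eC N N2 u v uv; first by move=> s /we <-; rewrite uw.
exact: square_filler uw vy hu hv.
Qed.

(** The default value outside the horn is a vertex of the horn, hence the
    condition on N. *)
Lemma horn_pmap (X : sSet) N (i : 'I_N.+1) (g : sMap (Lambda N i) X) :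
  0 < N -> exists w : pmap N X,
    simplicial_on (hornc i) w /\ forall m (a : Lambda N i m), w m (sval a) = g m a.
Proof.
move=> N0.
have gE m (a b : Lambda N i m) : sval a = sval b -> g m a = g m b.
  by case: a b => [a aH] [b bH] /= E; congr (g m _); apply: eq_exist.
have iH m : horn N i m (ord_const m i).
  have [j ji] : exists j, j != i.
    have [->|i0] := eqVneq i ord0; last by exists ord0; rewrite eq_sym.
    by exists ord_max; rewrite -val_eqE /= -lt0n.
  apply/hornE/horncP; exists j; split=> //; apply: contra ji => /suppP[k ->].
  by rewrite ffunE.
pose w m (s : ord_map m N) :=
  if pselect (horn N i m s) is left sH then g m (exist _ s sH)
  else g m (exist _ _ (iH m)).
have wE m (a : Lambda N i m) : w m (sval a) = g m a.
  by rewrite /w; case: pselect => [sH|/(_ (svalP a))[]]; apply: gE.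
exists w; split=> // m l s t /hornE sH.
by rewrite (wE m (exist _ s sH)) -app_act -wE.
Qed.

Lemma strongly_cartesian_cartesian (X Y : scSet) (f : scMap X Y) (e : X 1) :
  detects_thin f -> strongly_cartesian f e -> cartesian f e.
Proof.
move=> f_thin eC N N2 u v uv ue.
have [|w [wH wE]] := @horn_pmap X N ord_max u; first exact: ltnW.
have vu m (s : ord_map m N) (sH : horn N N m s) :
    f m (w m s) = act s (v N (ord_id N)).
  rewrite (wE m (exist _ s sH)) -yonedaE.
  exact: (scMap_app uv (exist _ s sH)).
have [||x [fx xw]] := eC N w (v N (ord_id N)) N2 _ _ I.
- by split=> // m s /(hornE (@ord_max N)); apply: vu.
- move=> s sE; have sH : horn N N 1 s.
    apply/(hornE (@ord_max N))/horncP; exists ord0; split.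
      by rewrite -val_eqE /= neq_ltn (ltnW N2).
    by rewrite -mem_verts sE !inE /=; lia.
  by rewrite (wE 1 (exist _ s sH)) ue.
have xT s : simp_of [:: [:: 0; N.-1; N]] s -> thin (yoneda x 2 s).
  move=> sT; apply/f_thin; rewrite /= app_act fx -yonedaE.
  by apply: (@sc_map_thin (scaled _) _ v); right.
exists (scaled_map xT); split; apply: scMap_eq; apply: sMap_eq => m s /=.
  by rewrite -wE; apply: xw; apply/(hornE (@ord_max N))/svalP.
by rewrite app_act fx -yonedaE.
Qed.

(** ** Collapsed horns *)

Section PushoutMaps.
Variables (A B C : sSet) (f : sMap A B) (g : sMap A C) (Z : sSet).

Lemma po_ext (h k : sMap (pushout f g) Z) :
  (forall n b, h n (po_inl f g n b) = k n (po_inl f g n b)) ->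
  (forall n c, h n (po_inr f g n c) = k n (po_inr f g n c)) -> h = k.
Proof.
move=> hl hr; apply: sMap_eq => n q; rewrite -[q]po_reprK.
by case: po_repr => x; [apply: hl | apply: hr].
Qed.

Variables (u : sMap B Z) (v : sMap C Z).
Hypothesis uv : forall n (a : A n), u n (f n a) = v n (g n a).

Lemma po_elim_inl n b : po_elim uv n (po_inl f g n b) = u n b.
Proof. exact: (sum_elim_repr uv (inl b)). Qed.

Lemma po_elim_inr n c : po_elim uv n (po_inr f g n c) = v n c.
Proof. exact: (sum_elim_repr uv (inr c)). Qed.

End PushoutMaps.

Lemma verts_face N (I : seq nat) m (s : Delta N m) :
  face N I m s <-> forall x : 'I_N.+1, x \in supp s -> val x \in I.
Proof.
split=> [sI x xs|sI x]; first by apply: sI; rewrite mem_verts.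
by case/mapP=> i _ ->; apply/sI/mem_supp.
Qed.

Lemma collapsed_horn_inl N i I m (b : Lambda N i m) :
  collapsed_horn N i I m (to_collapse _ m b) =
  to_collapse (face N I) m (horn_incl N i m b).
Proof. exact: po_elim_inl. Qed.

Lemma collapsed_horn_inr N i I m (c : Delta 0 m) :
  collapsed_horn N i I m (po_inr _ _ m c) =
  po_inr (incl (face N I)) (to_Delta0 _) m c.
Proof. exact: po_elim_inr. Qed.

Definition last_edge N : ord_map 1 N := omap 1 N (fun k => N.-1 + k).

Lemma last_edgeE N (i : 'I_2) : 0 < N -> last_edge N i = N.-1 + i :> nat.
Proof. by move=> N0; apply: omapE => *; lia. Qed.

Lemma verts_last_edge N : 0 < N -> verts (last_edge N) = [:: N.-1; N].
Proof.
move=> N0; rewrite verts_edge !last_edgeE // !inordK // addn0 addn1.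
by rewrite prednK.
Qed.

Lemma verts_inj m n (s t : ord_map m n) : verts s = verts t -> s = t.
Proof.
rewrite !vertsE => st; apply: ord_map_eq => i; apply: val_inj => /=.
have := congr1 (fun l => nth 0 l i) st.
by rewrite !nth_mkseq // inord_val.
Qed.

Lemma last_edge_inj N : 0 < N -> injective (last_edge N).
Proof.
move=> N0 i j /(congr1 val) /=; rewrite !last_edgeE // => /addnI.
exact: val_inj.
Qed.

Lemma face_last_edge N m (s : Delta N m) : 0 < N ->
  face N [:: N.-1; N] m s -> exists t, s = ord_comp (last_edge N) t.
Proof.
move=> N0 /verts_face sI; apply: ord_factor; first exact: last_edge_inj.
apply/subsetP=> x /sI xI; rewrite -mem_verts verts_last_edge //.
Qed.

Lemma last_edge_horn N : 1 < N -> supp (last_edge N) \in hornc (@ord_max N).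
Proof.
move=> N1; apply/horncP; exists ord0; split.
  by rewrite -val_eqE /=; lia.
by rewrite -mem_verts verts_last_edge ?(ltnW N1) // !inE /=; lia.
Qed.

Lemma degenerate_edge (X : sSet) (e : X 1) :
  degenerate e <-> exists z : X 0, e = act (ord_const 1 ord0) z.
Proof.
split=> [[[|m] [s [z [// _ ->]]]]|[z ->]].
  by exists z; rewrite [s](ord_map0 _ (ord_const 1 ord0)).
by exists 0, (ord_const 1 ord0), z.
Qed.

(** A right horn with degenerate last edge factors through the collapsed horn,
    and outer fibrations lift against collapsed horns without any thinness. *)
Lemma degenerate_strongly_cartesian (X Y : scSet) (f : scMap X Y) (e : X 1) :
  outer_fibration f -> degenerate e -> strongly_cartesian f e.
Proof.
case=> _ _ _ f_lift /degenerate_edge[z ez] N w y N2 [wH wf] we _.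
have N0 : 0 < N by apply: ltnW.
have edge m (s : Delta N m) : face N [:: N.-1; N] m s ->
    w m s = act (ord_const m ord0) z.
  case/(face_last_edge N0) => t ->.
  rewrite wH ?last_edge_horn // we ?verts_last_edge // ez -act_comp.
  by congr (act _ z); apply: ord_map0.
have uE m (a : sub_sSet (preim_subS (horn_incl N N) (face N [:: N.-1; N])) m) :
    horn_map (i := ord_max) wH m (incl _ m a) =
    yoneda z m (to_Delta0 _ m a).
  by rewrite /= edge //; apply: svalP a.
have vE m (a : sub_sSet (face N [:: N.-1; N]) m) :
    yoneda y m (incl _ m a) = yoneda (f 0 z) m (to_Delta0 _ m a).
  case/(face_last_edge N0): (svalP a) => t /= ->.
  rewrite act_comp -wf ?last_edge_horn // we ?verts_last_edge // ez -!app_act.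
  by rewrite -act_comp; congr (f m (act _ z)); apply: ord_map0.
have uv : sMap_comp f (po_elim uE) =
    sMap_comp (po_elim vE) (collapsed_horn N N [:: N.-1; N]).
  apply: po_ext => m b.
    transitivity (act (sval b) y).
      rewrite -wf; last by apply/(hornE (@ord_max N))/svalP.
      exact (congr1 (f m) (po_elim_inl uE b)).
    symmetry; exact (etrans (congr1 (po_elim vE m) (@collapsed_horn_inl N N [:: N.-1; N] m b)) (po_elim_inl vE _)).
  transitivity (act b (f 0 z)).
    rewrite -[RHS]app_act; exact (congr1 (f m) (po_elim_inr uE b)).
  symmetry; exact (etrans (congr1 (po_elim vE m) (@collapsed_horn_inr N N [:: N.-1; N] m b)) (po_elim_inr vE _)).
have [h [hu hv]] := f_lift N N2 (po_elim uE) (po_elim vE) uv.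
pose top := to_collapse (face N [:: N.-1; N]) N (ord_id N).
exists (app h top); split.
  transitivity (po_elim vE N top); first exact (sMap_app hv top).
  by rewrite [LHS](po_elim_inl vE) /= act_id.
move=> m s sH; have sH' : horn N N m s by apply/(hornE (@ord_max N)).
transitivity (app h (to_collapse (face N [:: N.-1; N]) m s)).
  exact (esym (yonedaE (sMap_comp h (to_collapse (face N [:: N.-1; N]))) s)).
rewrite -[s]/(horn_incl N N m (exist _ s sH')) -collapsed_horn_inl.
exact (etrans (sMap_app hu _) (po_elim_inl uE (exist _ s sH'))).
Qed.

(** * Pivot extensions in fibrations *)

Lemma noninjective_factor m n (t : ord_map m n) i j : i != j -> t i = t j ->
  exists k (s : ord_map k n) (q : ord_map m k), k < m /\ t = ord_comp s q.
Proof.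
move=> ij tij.
have t_card : #|supp t| < m.+1.
  rewrite ltn_neqAle -[X in _ <= X]card_ord leq_imset_card andbT.
  rewrite -[X in _ != X]card_ord; apply/imset_injP => t_inj.
  by case/eqP: ij; apply: t_inj.
have [|k [s [s_inj sE]]] := @face_exists _ (supp t).
  by apply/set0Pn; exists (t i); apply: mem_supp.
have [|q tE] := ord_factor (r := t) s_inj; first by rewrite sE.
exists k, s, q; split=> //.
by move: t_card; rewrite -sE /supp card_imset // card_ord ltnS.
Qed.

Lemma triangle_mono n (t : ord_map 2 n) :
  t (inord 0) <= t (inord 1) <= t (inord 2).
Proof. by rewrite !ord_mapP // ?inordK. Qed.

Lemma mem_triangle n (t : ord_map 2 n) x :
  (x \in supp t) = [|| x == t (inord 0), x == t (inord 1) | x == t (inord 2)].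
Proof. by rewrite -mem_verts verts_triangle !inE. Qed.

Lemma degenerate_triangle (X : sSet) n (t : ord_map 2 n) (x : X n) :
  ~~ (t (inord 0) < t (inord 1) < t (inord 2)) -> degenerate (act t x).
Proof.
have /andP[t01 t12] := triangle_mono t.
rewrite negb_and -!leqNgt => t_deg.
have [i [j [ij tij]]] : exists i j, i != j /\ t i = t j.
  case/orP: t_deg => [t10|t21]; [exists (inord 0), (inord 1) | exists (inord 1), (inord 2)];
    rewrite -val_eqE /= !inordK //; split=> //; apply: val_inj; apply/eqP;
    by rewrite /= eqn_leq ?t01 ?t12.
have [k [s [q [k2 ->]]]] := noninjective_factor ij tij.
by exists k, q, (act s x); rewrite act_comp.
Qed.

(** The triangle formed by P and its two neighbours in S. *)
Definition between M (S : {set 'I_M.+1}) (P : 'I_M.+1) (s : ord_map 2 M) : Prop :=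
  [/\ s (inord 0) \in S, s (inord 1) = P, s (inord 2) \in S,
      s (inord 0) < P < s (inord 2)
    & forall z, z \in S -> (z < P -> z <= s (inord 0)) /\ (P < z -> s (inord 2) <= z)].

Definition pivotal M (K K' : {set {set 'I_M.+1}}) (P : 'I_M.+1) : Prop :=
  [/\ complex K, complex K', K \subset K'
    & forall S, S \in K' -> S \notin K -> P |: S \in K' /\ S :\ P \notin K].

Definition inner_pivotal M (S : {set 'I_M.+1}) (P : 'I_M.+1) : Prop :=
  (exists2 q, q \in S & q < P) /\ (exists2 r, r \in S & P < r).

Lemma inner_pivotal_index M N (d : ord_map N M) (i : 'I_N.+1) :
  injective d -> inner_pivotal (supp d) (d i) -> 0 < i < N.
Proof.
move=> d_inj [[_ /suppP[j ->]]]; rewrite ord_map_lt // => ji.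
case=> _ /suppP[k ->]; rewrite ord_map_lt // => ik.
by rewrite (leq_ltn_trans _ ji) //= (leq_trans ik) // -ltnS.
Qed.

Lemma consecutive_between M N (d : ord_map N M) (i : 'I_N.+1) (s : ord_map 2 N) :
  injective d -> consecutive i s -> between (supp d) (d i) (ord_comp d s).
Proof.
move=> d_inj [s0 s1 s2]; split; rewrite ?ord_compE ?mem_supp ?s1 //.
  by rewrite !ord_map_lt // s2 -s0 !ltnSn.
by move=> _ /suppP[j ->]; rewrite !ord_map_lt // !ord_map_le // s2 -s0 ltnS.
Qed.

Definition lift_on (X Y : sSet) (f : sMap X Y) M (K : {set {set 'I_M.+1}})
    (v : Y M) (u : pmap M X) : Prop :=
  simplicial_on K u /\
  forall m (s : ord_map m M), supp s \in K -> f m (u m s) = act s v.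

Section RelativePivot.
Variables (X Y : scSet) (f : scMap X Y).
Variables (M : nat) (K K' : {set {set 'I_M.+1}}) (P : 'I_M.+1).
Variables (v : Y M) (u : pmap M X).
Hypotheses (KK' : pivotal K K' P) (uK : lift_on f K v u).

(** The invariant is to lie over v and to extend u; so the horns to be filled
    are known where they meet K. *)
Lemma relative_pivot :
  (forall N (d : ord_map N M) (i : 'I_N.+1) (w : pmap N X),
     injective d -> d i = P -> supp d \in K' -> supp d \notin K ->
     horn_over f i w (act d v) ->
     (forall k (t : ord_map k N), supp t \in hornc i ->
        supp (ord_comp d t) \in K -> w k t = u (ord_comp d t)) ->
     filler f i w (act d v)) ->
  exists2 u' : pmap M X, lift_on f K' v u' & agree_on K u' u.
Proof.
case: KK' => Kc K'c sub toggle fill.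
pose G k (s : ord_map k M) (x : X k) :=
  f k x = act s v /\ (supp s \in K -> x = u s).
have [N d i w d_inj di dK' dK dH wH wG|k s sK|u' [u'K' u'u u'G]] :=
    pivot_extend (G := G) Kc K'c sub toggle _ (proj1 uK).
- have wy : horn_over f i w (act d v).
    by split=> // m s /wG[-> _]; rewrite act_comp.
  have [|x [fx xw]] := fill N d i w d_inj di dK' dK wy.
    by move=> k t /wG[].
  exists x; split=> // k t; split; first by rewrite app_act fx act_comp.
  move=> tK; have tH := dH _ _ tK.
  by rewrite -[LHS]/(represent x t) xw // (proj2 (wG _ _ tH)).
- by split=> //; apply: (proj2 uK).
- by exists u' => //; split=> // m s /u'G[].
Qed.

(** Each added pair is an inner horn, whose required thin triangle is that of
    the neighbours of P; it suffices that it is thin in the base. *)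
Lemma inner_pivot : detects_thin f ->
  (forall n i, 0 < i < n -> has_lifting (C := scSetCat) (sc_inner_horn n i) f) ->
  (forall S, S \in K' -> S \notin K -> P \in S -> inner_pivotal S P) ->
  (forall S (s : ord_map 2 M), S \in K' -> S \notin K -> between S P s ->
     thin (act s v)) ->
  exists2 u' : pmap M X, lift_on f K' v u' & agree_on K u' u.
Proof.
move=> f_thin f_lift inner v_thin; apply: relative_pivot => N d i w d_inj di dK' dK wy _.
have i_inner : 0 < i < N.
  by apply: (inner_pivotal_index d_inj); rewrite di; apply: inner => //; rewrite -di mem_supp.
apply: inner_filler (f_lift _ _ i_inner) wy _ => // s si.
rewrite -act_comp; apply: (v_thin (supp d)) => //.
by rewrite -di; apply: consecutive_between.
Qed.

(** Each added pair is a right horn.  The edge s is its last edge, and the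
    triangles t include its triangle {0, N-1, N}. *)
Lemma right_pivot :
  (forall S, S \in K' -> S \notin K -> P \in S ->
    [/\ forall z, z \in S -> z <= P, exists q q', [/\ q \in S, q' \in S & q < q' < P]
      & forall s : ord_map 1 M, s (inord 0) \in S -> s (inord 0) < P ->
          s (inord 1) = P -> (forall z, z \in S -> z < P -> z <= s (inord 0)) ->
        supp s \in K /\ (strongly_cartesian f (u s) \/
          right_fills f (@thin_last Y) (u s) /\
          forall t : ord_map 2 M, t (inord 0) \in S -> t (inord 1) = s (inord 0) ->
            t (inord 2) = P -> thin (act t v))]) ->
  exists2 u' : pmap M X, lift_on f K' v u' & agree_on K u' u.
Proof.
move=> right; apply: relative_pivot => N d i w d_inj di dK' dK wy wu.
have [] := right _ dK' dK; first by rewrite -di mem_supp.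
rewrite -di => dmax [_ [_ [/suppP[j ->] /suppP[k ->]]]].
rewrite !ord_map_lt // => /andP[jk ki] dlast.
have iN : i = ord_max.
  apply: val_inj; apply/eqP; rewrite eqn_leq leq_ord /=.
  by have := dmax _ (mem_supp d ord_max); rewrite ord_map_le.
move: iN ki di dmax wy wu dlast => -> /= ki di dmax wy wu dlast.
have N2 : 1 < N by apply: leq_ltn_trans ki; apply: leq_ltn_trans jk.
have [e0 e1] : last_edge N (inord 0) = N.-1 :> nat /\ last_edge N (inord 1) = ord_max.
  have N0 : 0 < N by apply: ltnW.
  split; rewrite ?last_edgeE ?inordK ?addn0 //.
  by apply: val_inj; rewrite /= last_edgeE // inordK // addn1 prednK.
have [||||eK euC] := dlast (ord_comp d (last_edge N)).
- by rewrite ord_compE mem_supp.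
- by rewrite ord_compE ord_map_lt // e0 /=; lia.
- by rewrite ord_compE e1.
- move=> _ /suppP[l ->]; rewrite !ord_compE ord_map_lt // ord_map_le // e0 /=.
  by lia.
have we : forall s : ord_map 1 N, verts s = [:: N.-1; N] ->
    w 1 s = u (ord_comp d (last_edge N)).
  move=> s; rewrite -verts_last_edge ?(ltnW N2) // => /verts_inj->.
  by apply: wu => //; apply: last_edge_horn.
case: euC => [eC|[eC t_thin]]; first exact: eC.
apply: eC => // s sE; rewrite -act_comp; apply: t_thin; rewrite ?ord_compE ?mem_supp //.
  congr (d _); apply: val_inj; rewrite /= e0.
  by move: sE; rewrite verts_triangle => -[].
congr (d _); apply: val_inj => /=.
by move: sE; rewrite verts_triangle => -[].
Qed.

End RelativePivot.

(** A condition on triangles, as an invariant on simplices of any dimension. *)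
Definition on_triangles M (X : sSet) (Q : ord_map 2 M -> X 2 -> Prop) k :
    ord_map k M -> X k -> Prop :=
  match k with 2 => Q | _ => fun _ _ => True end.

Lemma on_trianglesP M (X : sSet) (Q : ord_map 2 M -> X 2 -> Prop)
    (R : forall k, ord_map k M -> Prop) (g : forall k, ord_map k M -> X k) :
  (forall s, R 2 s -> Q s (g 2 s)) ->
  forall k s, R k s -> on_triangles Q s (g k s).
Proof. by move=> H [|[|[|k]]] s //=; apply: H. Qed.

(** Without a base in which thinness could be checked, the thin triangles
    needed by an inner horn have to be produced by the earlier fillings: every
    triangle with middle vertex P and last vertex in R is made thin when it is
    added, and the next vertex after P always lies in R. *)
Lemma absolute_pivot (Y : scSet) M (K K' : {set {set 'I_M.+1}})
    (P : 'I_M.+1) (R : {set 'I_M.+1}) (u : pmap M Y) :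
  (forall n i, 0 < i < n -> has_extension (C := scSetCat) (sc_inner_horn n i) Y) ->
  pivotal K K' P ->
  (forall S, S \in K' -> S \notin K -> P \in S -> inner_pivotal S P) ->
  (forall S z, S \in K' -> S \notin K -> P \in S -> z \in S -> P < z ->
     (forall z', z' \in S -> P < z' -> z <= z') -> z \in R) ->
  simplicial_on K u ->
  (forall s : ord_map 2 M, supp s \in K -> s (inord 1) = P ->
     s (inord 2) \in R -> thin (u 2 s)) ->
  exists u' : pmap M Y, [/\ simplicial_on K' u', agree_on K u' u
    & forall s : ord_map 2 M, supp s \in K' -> s (inord 1) = P ->
        s (inord 2) \in R -> thin (u' 2 s)].
Proof.
move=> Y_ext [Kc K'c sub toggle] inner next uK u_thin.
pose Q (s : ord_map 2 M) (x : Y 2) :=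
  s (inord 1) = P -> s (inord 2) \in R -> thin x.
have [N d i w d_inj di dK' dK dH wH wG|k s sK|u' [u'K' u'u u'G]] :=
    pivot_extend (G := on_triangles Q) Kc K'c sub toggle _ uK; last 2 first.
- by move: sK; apply: (on_trianglesP (R := fun k s => supp s \in K)) => {}s /u_thin.
- by exists u'; split=> // s sK; apply: (u'G _ s sK).
have Pd : P \in supp d by rewrite -di mem_supp.
have i_inner : 0 < i < N.
  by apply: (inner_pivotal_index d_inj); rewrite di; apply: inner.
have [s si sH|x xw x_thin] := inner_extension i_inner (Y_ext _ _ i_inner) wH.
  apply: (wG 2 s sH); have [_ s1 s20 s2 sb] := consecutive_between d_inj si.
    by rewrite -di.
  apply: (next _ _ dK' dK Pd s20).
    by rewrite -di; case/andP: s2.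
  by move=> z zd; have [_] := sb z zd; rewrite di.
exists x; split=> //; case=> [|[|[|k]]] //= t t1 t2.
have [t012|/degenerate_triangle] := boolP (t (inord 0) < t (inord 1) < t (inord 2));
  last by move/(_ _ x)/thin_degenerate.
have {}t1 : t (inord 1) = i by apply: d_inj; rewrite di -t1 ord_compE.
have [tH|tH] := boolP (supp t \in hornc i).
  rewrite -[act t x]/(represent x t) xw //; apply: (wG 2 t tH) => //.
  by rewrite ord_compE t1.
apply: x_thin; move: t012; rewrite t1 => /andP[t0i it2].
have mem j : j != i -> (j == t (inord 0)) || (j == t (inord 2)).
  move=> ji; move: tH; apply: contraR => jt; apply/horncP; exists j; split=> //.
  by move: jt; rewrite mem_triangle t1 (negbTE ji).
split=> //; last first.
  have iN : i.+1 < N.+1 by case/andP: i_inner.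
  have /mem : Ordinal iN != i by rewrite -val_eqE /=; lia.
  by rewrite -!val_eqE /= => /orP[/eqP E|/eqP E]; lia.
have iN : i.-1 < N.+1 by have := ltn_ord i; lia.
have /mem : Ordinal iN != i by rewrite -val_eqE /=; lia.
by rewrite -!val_eqE /= => /orP[/eqP E|/eqP E]; lia.
Qed.

(** * Horns joined with a small simplex *)

Section Join.

(** The simplex of dimension k.+1 + L is the join of J, with vertices
    0, ..., k, and a simplex of dimension L. *)
Variables (k L : nat).

Local Notation M := (k.+1 + L).
Implicit Types (S T : {set 'I_M.+1}) (P : 'I_M.+1).

Definition last_face : ord_map L M := omap L M (fun j => k.+1 + j).

Lemma last_faceE (i : 'I_L.+1) : last_face i = k.+1 + i :> nat.
Proof. by apply: omapE => *; lia. Qed.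

Lemma last_face_inj : injective last_face.
Proof. by move=> i j /(congr1 val)/=; rewrite !last_faceE => /addnI/val_inj. Qed.

Lemma mem_last_face z : (z \in supp last_face) = (k < z).
Proof.
apply/suppP/idP => [[i ->]|kz]; first by rewrite last_faceE; lia.
have zL : z - k.+1 < L.+1 by have := ltn_ord z; lia.
by exists (Ordinal zL); apply: val_inj; rewrite /= last_faceE /=; lia.
Qed.

Lemma last_face_factor m (s : ord_map m M) : (forall z, z \in supp s -> k < z) ->
  exists2 t, s = ord_comp last_face t & forall i, t i = s i - k.+1 :> nat.
Proof.
move=> sk; have [|t ->] := ord_factor (r := s) last_face_inj.
  by apply/subsetP=> z /sk; rewrite mem_last_face.
by exists t => // i; rewrite ord_compE last_faceE; lia.
Qed.

Definition J : {set 'I_M.+1} := [set z : 'I_M.+1 | z <= k].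

(** Meeting J, phrased through the complement of J. *)
Definition touches (S : {set 'I_M.+1}) : bool := ~~ (S \subset supp last_face).

Lemma touchesP (S : {set 'I_M.+1}) : reflect (exists2 z, z \in S & z <= k) (touches S).
Proof.
apply: (iffP subsetPn) => [[z zS]|[z zS zk]].
  by rewrite mem_last_face -leqNgt; exists z.
by exists z; rewrite // mem_last_face -leqNgt.
Qed.

Lemma J_setU1 P S : k < P -> (J \subset P |: S) = (J \subset S).
Proof.
move=> kP; apply/subsetP/subsetP => JS z zJ; last by rewrite !inE JS ?orbT.
have := JS z zJ; rewrite !inE => /predU1P[zP|//].
by move: zJ; rewrite zP inE leqNgt kP.
Qed.

Lemma J_setD1 P S : k < P -> (J \subset S :\ P) = (J \subset S).
Proof. by move=> kP; rewrite subsetD1 inE -ltnNge kP andbT. Qed.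

Lemma touches_setD1 P S : k < P -> touches (S :\ P) = touches S.
Proof.
move=> kP; apply/touchesP/touchesP => -[z zS zk]; exists z => //.
  by move: zS; rewrite inE => /andP[].
by rewrite !inE zS andbT; apply: contraTneq zk => ->; rewrite -ltnNge.
Qed.

Lemma touchesS S T : S \subset T -> touches S -> touches T.
Proof. by move=> ST; apply: contra; apply: subset_trans. Qed.

Lemma J_touches S : J \subset S -> touches S.
Proof.
move=> JS; apply/touchesP; exists ord0 => //.
by apply: (subsetP JS); rewrite inE.
Qed.

(** The face chord_join is the join of J with the edge from the vertex 0 to the
    vertex c of the simplex of dimension L. *)
Variable c : nat.
Hypothesis cL : 0 < c <= L.

Definition chord_join : ord_map k.+2 M :=
  omap k.+2 M (fun j => if j <= k.+1 then j else k.+1 + c).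

Definition chord : ord_map 1 L := omap 1 L (fun j => j * c).

Lemma chord_joinE (i : 'I_k.+3) : chord_join i = (if i <= k.+1 then i : nat else k.+1 + c) :> nat.
Proof. by apply: omapE => [j|j j'] *; do ?case: ifP; lia. Qed.

Lemma chordE (i : 'I_2) : chord i = i * c :> nat.
Proof. by apply: omapE => [j|j j']; nia. Qed.

Lemma chord_join_inj : injective chord_join.
Proof.
move=> i j /(congr1 val)/=; rewrite !chord_joinE => ij; apply: val_inj => /=.
have ik := ltn_ord i; have jk := ltn_ord j.
by move: ij; case: (leqP i k.+1) => ?; case: (leqP j k.+1) => ?; lia.
Qed.

Lemma chord_inj : injective chord.
Proof.
move=> i j /(congr1 val)/=; rewrite !chordE => ij; apply: val_inj => /=; nia.
Qed.

Lemma mem_chord_join z : (z \in supp chord_join) = (z <= k.+1) || (z == k.+1 + c :> nat).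
Proof.
apply/suppP/idP => [[i ->]|zE]; first by rewrite chord_joinE; case: ifP => [->//|]; rewrite eqxx orbT.
have [zk|zk] := leqP z k.+1.
  have zk' : z < k.+3 by lia.
  by exists (Ordinal zk'); apply: val_inj; rewrite /= chord_joinE /= zk.
by exists ord_max; apply: val_inj; rewrite /= chord_joinE /= ltnn; lia.
Qed.

Lemma chord_join_last_edge : ord_comp chord_join (last_edge k.+2) = ord_comp last_face chord.
Proof.
apply: ord_map_eq => i; apply: val_inj; rewrite !ord_compE /= chord_joinE last_faceE chordE.
by rewrite last_edgeE //=; case: i => [[|[|i]] //= ?]; case: ifP; lia.
Qed.

(** The domain on which a map to the base is given at first. *)
Definition base_complex : {set {set 'I_M.+1}} :=
  [set S : {set 'I_M.+1} | (S \subset supp chord_join) || ~~ touches S].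

(** The same with the face chord_join replaced by its right horn: the domain on
    which a map to X is given at first. *)
Definition horn_complex : {set {set 'I_M.+1}} :=
  [set S : {set 'I_M.+1} | (S \subset supp chord_join) &&
     ~~ ((J \subset S) && (inord k.+1 \in S)) || ~~ touches S].

Lemma base_complexE : base_complex = push_complex chord_join setT :|: powerset (supp last_face).
Proof. by apply/setP=> S; rewrite !inE andbT /touches negbK. Qed.

Lemma horn_complexE :
  horn_complex = push_complex chord_join (hornc ord_max) :|: powerset (supp last_face).
Proof.
have chord_join_low (z : 'I_M.+1) (zk : z < k.+2) : chord_join (inord z) = z.
  by apply: val_inj; rewrite /= chord_joinE inordK ?(leq_trans zk) // ifT.
apply/setP=> S; rewrite !inE /touches negbK; congr (_ && _ || _).
congr negb; apply/andP/subsetP => [[/subsetP JS aS] i|H].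
  rewrite !inE => im; have ik : i < k.+2.
    by rewrite ltn_neqAle -ltnS ltn_ord andbT -val_eqE in im *.
  have [ik'|ik'] := leqP i k; first by apply: JS; rewrite inE chord_joinE ifT.
  have {}ik : i = k.+1 :> nat by lia.
  rewrite (_ : chord_join i = inord k.+1) //; apply: val_inj.
  by rewrite /= chord_joinE ik leqnn inordK //; lia.
have low (z : 'I_M.+1) : z < k.+2 -> z \in S.
  move=> zk; rewrite -(chord_join_low z zk).
  have /H : (inord z : 'I_k.+3) \in [set~ ord_max].
    by rewrite !inE -val_eqE /= inordK ?(leq_trans zk) // neq_ltn zk.
  by rewrite inE.
split; first by apply/subsetP=> z; rewrite inE => zk; apply: low; lia.
by apply: low; rewrite inordK //; lia.
Qed.

Section Attach.
Variables (Z : sSet) (x : Z L).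

Lemma attach (K : {set {set 'I_k.+3}}) (w : pmap k.+2 Z) :
  complex K -> supp (last_edge k.+2) \in K -> simplicial_on K w ->
  w 1 (last_edge k.+2) = act chord x ->
  exists u : pmap M Z,
    [/\ simplicial_on (push_complex chord_join K :|: powerset (supp last_face)) u,
        forall m (t : ord_map m k.+2), supp t \in K -> u m (ord_comp chord_join t) = w m t
      & forall m (t : ord_map m L), u m (ord_comp last_face t) = act t x].
Proof.
move=> Kc eK wK wx; apply: glue_along eK wx => //.
- exact: chord_join_inj.
- exact: last_face_inj.
- exact: chord_join_last_edge.
- apply/subsetP=> z; rewrite inE mem_chord_join mem_last_face => /andP[zd kz].
  rewrite supp_comp; have [zk|zk] := leqP z k.+1.
    apply/imsetP; exists (chord (inord 0)); first exact: mem_supp.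
    by apply: val_inj; rewrite /= last_faceE chordE inordK //; lia.
  apply/imsetP; exists (chord (inord 1)); first exact: mem_supp.
  by apply: val_inj; rewrite /= last_faceE chordE inordK //; lia.
- exact: chord_inj.
Qed.

End Attach.

(** To fill a horn in X whose last edge is an edge of the simplex x, attach x
    to it and extend the result to the faces of the join, in Y and then in X
    over Y. *)
Lemma join_filler (X Y : scSet) (f : scMap X Y) (C : Y M -> Prop)
    (w : pmap k.+2 X) (y : Y k.+2) (x : X L) (K : {set {set 'I_M.+1}}) :
  horn_over f ord_max w y -> w 1 (last_edge k.+2) = act chord x ->
  horn_complex \subset K -> supp chord_join \in K ->
  (forall u : pmap M Y, simplicial_on base_complex u ->
     u _ chord_join = y -> (forall m (t : ord_map m L), u m (ord_comp last_face t) = f m (act t x)) ->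
     exists2 v : Y M, agree_on base_complex (represent v) u & C v) ->
  (forall (u : pmap M X) (v : Y M), C v -> lift_on f horn_complex v u ->
     act chord_join v = y -> act last_face v = f L x ->
     (forall m (t : ord_map m L), u m (ord_comp last_face t) = act t x) ->
     exists2 u' : pmap M X, lift_on f K v u' & agree_on horn_complex u' u) ->
  filler f ord_max w y.
Proof.
move=> [wH wy] wx HK dK extY extX.
have eH := @last_edge_horn k.+2 isT.
have [|||| uY [uYb uYd uYt]] := @attach Y (f L x) setT (represent y).
- by move=> S T; rewrite !inE.
- by rewrite inE.
- by move=> m l s t _; rewrite /represent act_comp.
- by rewrite /represent -wy // wx app_act.
rewrite -base_complexE in uYb.
have [||v vu Cv] := extY uY uYb.
- by rewrite -[chord_join]ord_id_comp uYd ?inE // /represent act_id.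
- by move=> m t; rewrite uYt app_act.
have vd : act chord_join v = y.
  rewrite -[LHS]/(represent v chord_join) vu; last by rewrite inE subxx.
  by rewrite -[chord_join]ord_id_comp uYd ?inE // /represent act_id.
have vt : act last_face v = f L x.
  rewrite -[LHS]/(represent v last_face) vu; last by rewrite inE /touches subxx orbT.
  by rewrite -[last_face]ord_id_comp uYt act_id.
have [u [uH ud ut]] := attach (@complex_hornc _ _) eH wH wx.
rewrite -horn_complexE in uH.
have uv : lift_on f horn_complex v u.
  split=> // m s; rewrite inE /touches negbK.
  case: (boolP (supp s \subset supp last_face)) => [|nlast].
    by case/(ord_factor last_face_inj)=> t -> _; rewrite ut app_act -vt act_comp.
  rewrite orbF => sH; have sd : supp s \subset supp chord_join by case/andP: sH.
  have [t st] := ord_factor chord_join_inj sd.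
  have tH : supp t \in hornc ord_max.
    rewrite -(push_complexP _ _ chord_join_inj) -st.
    have : supp s \in horn_complex by rewrite inE sH.
    by rewrite horn_complexE inE powersetE (negbTE nlast) orbF.
  by rewrite st ud // wy // -vd act_comp.
have [u' [u'K u'v] u'u] := extX u v Cv uv vd vt ut.
exists (u' _ chord_join); split; first by rewrite u'v.
move=> m t tH; rewrite /represent -u'K // u'u ?ud //.
rewrite horn_complexE inE push_complexP ?tH //; exact: chord_join_inj.
Qed.

End Join.

(** ** Extension steps in a join *)

Definition upward M (E : {set 'I_M.+1} -> bool) : Prop :=
  forall S T : {set 'I_M.+1}, T \subset S -> E T -> E S.

Definition lacking M (E : {set 'I_M.+1} -> bool) : {set {set 'I_M.+1}} :=
  [set S : {set 'I_M.+1} | ~~ E S].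

(** Every domain in a join argument consists of the faces which lack a
    condition stable under enlarging faces; this makes the containments
    between them and the effect of a pivot propositional questions about
    which vertices a face has. *)
Lemma complex_lacking M (E : {set 'I_M.+1} -> bool) :
  upward E -> complex (lacking E).
Proof. by move=> Eup S T; rewrite !inE => + TS; apply: contra; apply: Eup. Qed.

Lemma upward_and M (E E' : {set 'I_M.+1} -> bool) :
  upward E -> upward E' -> upward (fun S => E S && E' S).
Proof. by move=> Eu E'u S T TS /andP[/(Eu S T TS)-> /(E'u S T TS)->]. Qed.

Lemma upward_or M (E E' : {set 'I_M.+1} -> bool) :
  upward E -> upward E' -> upward (fun S => E S || E' S).
Proof.
by move=> Eu E'u S T TS /orP[/(Eu S T TS)->//|/(E'u S T TS)->]; rewrite orbT.
Qed.

Lemma upward_mem M (x : 'I_M.+1) : upward (fun S => x \in S).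
Proof. by move=> S T /subsetP; apply. Qed.

Lemma upward_false M : @upward M (fun=> false).
Proof. by []. Qed.

Lemma upward_sub M (I : {set 'I_M.+1}) : upward (fun S => I \subset S).
Proof. by move=> S T TS IT; apply: subset_trans IT TS. Qed.

Lemma upward_touches k L : upward (@touches k L).
Proof. by move=> S T; apply: touchesS. Qed.

Ltac prove_upward := do ?[apply: upward_and | apply: upward_or | exact: upward_mem
  | exact: upward_false | exact: upward_sub | exact: upward_touches].

Section JoinSteps.
Variables (X Y : scSet) (f : scMap X Y).
Hypothesis f_thin : detects_thin f.
Hypothesis f_lift :
  forall n i, 0 < i < n -> has_lifting (C := scSetCat) (sc_inner_horn n i) f.
Hypothesis Y_ext :
  forall n i, 0 < i < n -> has_extension (C := scSetCat) (sc_inner_horn n i) Y.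

Variables (k L : nat).
Local Notation M := (k.+1 + L).
Implicit Types (E : {set 'I_M.+1} -> bool) (S : {set 'I_M.+1}) (P : 'I_M.+1).

(** Passing from E to E' adds the faces satisfying E and not E'; the last
    condition pairs them up under adding and removing P. *)
Definition step_at P E E' : Prop :=
  [/\ upward E, upward E', forall S, E S -> touches S, k < P
    & forall S, (E' S -> E S) /\
        (E S -> ~~ E' S -> ~~ E' (P |: S) /\ E (S :\ P))].

Lemma step_pivotal P E E' : step_at P E E' -> pivotal (lacking E) (lacking E') P.
Proof.
case=> Eu E'u _ _ step; split; do ?exact: complex_lacking.
  by apply/subsetP=> S; rewrite !inE; apply: contra; apply: (proj1 (step S)).
by move=> S; rewrite !inE !negbK => E'S ES; have [_] := step S; apply.
Qed.

Section Over.
Variables (v : Y M) (x : X L) (u0 : pmap M X) (K0 : {set {set 'I_M.+1}}).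

(** A stage of the extension in X: the simplex x stays attached, and nothing
    is changed on the original domain K0. *)
Definition partial_lift E (u : pmap M X) : Prop :=
  [/\ lift_on f (lacking E) v u, K0 \subset lacking E, agree_on K0 u u0
    & forall m (t : ord_map m L), u m (ord_comp (last_face k L) t) = act t x].

Lemma partial_lift_step P E E' u : step_at P E E' -> partial_lift E u ->
  (exists2 u', lift_on f (lacking E') v u' & agree_on (lacking E) u' u) ->
  exists u', partial_lift E' u'.
Proof.
move=> EE' [_ K0E uu0 ux] [u' u'E' u'u].
have [Ec E'c sub _] := step_pivotal EE'; have [_ _ Etouch _ _] := EE'.
exists u'; split=> //; first exact: subset_trans sub.
  by move=> m s sK0; rewrite u'u ?uu0 // (subsetP K0E).
move=> m t; rewrite u'u ?ux // inE; apply/negP => /Etouch.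
by rewrite /touches supp_comp_sub.
Qed.

(** Every added face meets J, which precedes P; so P is inner as soon as the
    face has a later vertex. *)
Lemma inner_step P E E' u : step_at P E E' ->
  (forall S, E S -> ~~ E' S -> P \in S -> exists2 r, r \in S & P < r) ->
  (forall S (s : ord_map 2 M), E S -> ~~ E' S -> between S P s -> thin (act s v)) ->
  partial_lift E u -> exists u', partial_lift E' u'.
Proof.
move=> EE' r v_thin uE; apply: (partial_lift_step EE' uE).
case: uE => uE _ _ _; have [_ _ Etouch kP _] := EE'.
apply: (inner_pivot (step_pivotal EE') uE) => // [S|S s].
  rewrite !inE negbK => E'S ES PS; split; last exact: r ES E'S PS.
  by have /touchesP[q qS qk] := Etouch S ES; exists q; rewrite ?(leq_ltn_trans qk).
by rewrite !inE negbK => E'S ES; apply: (v_thin S).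
Qed.

Lemma right_step P E E' u : step_at P E E' ->
  (forall S, E S -> ~~ E' S -> P \in S ->
    [/\ forall z, z \in S -> z <= P, exists2 q, q \in S & k < q < P
      & forall p (e : ord_map 1 L), p \in S -> k < p < P ->
          (forall z, z \in S -> z < P -> z <= p) ->
          verts e = [:: p - k.+1; P - k.+1] ->
        strongly_cartesian f (act e x) \/
        right_fills f (@thin_last Y) (act e x) /\
          forall t : ord_map 2 M, t (inord 1) = p -> t (inord 2) = P ->
            thin (act t v)]) ->
  partial_lift E u -> exists u', partial_lift E' u'.
Proof.
move=> EE' right uE; apply: (partial_lift_step EE' uE).
case: uE => uE _ _ ux; have [_ _ Etouch kP _] := EE'.
apply: (right_pivot (step_pivotal EE') uE) => S.
rewrite !inE negbK => E'S ES PS; have [Smax [q qS /andP[kq qP]] e_right] := right S ES E'S PS.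
split=> //.
  have /touchesP[p pS pk] := Etouch S ES.
  by exists p, q; rewrite pS qS (leq_ltn_trans pk).
move=> s s0 s0P s1 s_last.
have ks0 : k < s (inord 0) by apply: leq_trans kq _; apply: s_last.
have sk z : z \in supp s -> k < z.
  by rewrite -mem_verts verts_edge !inE s1 => /orP[]/eqP->.
split.
  rewrite !inE; apply/negP => /Etouch/touchesP[z /sk].
  by rewrite ltnNge => /negP.
have [e es ee] := last_face_factor sk; rewrite es ux.
have [||||e_sc|[e_fills t_thin]] := e_right (s (inord 0)) e.
- by [].
- by rewrite ks0.
- by [].
- by rewrite verts_edge !ee s1.
- by left.
by right; split=> // t _; rewrite -es; apply: t_thin.
Qed.

End Over.

(** At the start the triangles of x are available: a triangle of the domain
    whose last vertex is in R does not meet J. *)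
Lemma base_step P (R : {set 'I_M.+1}) E (u : pmap M Y) (x : Y L) :
  step_at P E (fun=> false) ->
  (forall S, E S -> P \in S -> exists2 r, r \in S & P < r) ->
  (forall S z, E S -> z \in S -> P < z ->
     (forall z', z' \in S -> P < z' -> z <= z') -> z \in R) ->
  (forall S z, z \in S -> z \in R -> touches S -> E S) ->
  simplicial_on (lacking E) u ->
  (forall m (t : ord_map m L), u m (ord_comp (last_face k L) t) = act t x) ->
  (forall t : ord_map 2 L, thin (act t x)) ->
  exists2 v : Y M, agree_on (lacking E) (represent v) u
    & forall s : ord_map 2 M, s (inord 1) = P -> s (inord 2) \in R -> thin (act s v).
Proof.
move=> EE' r next RE uE ux x_thin; have [_ _ Etouch kP _] := EE'.
have [|||u' [u'E u'u u'_thin]] :=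
  absolute_pivot (R := R) Y_ext (step_pivotal EE') _ _ uE.
- move=> S _; rewrite inE negbK => ES PS; split; last exact: r ES PS.
  by have /touchesP[q qS qk] := Etouch S ES; exists q; rewrite ?(leq_ltn_trans qk).
- by move=> S z _; rewrite inE negbK => ES _; apply: next ES.
- move=> s; rewrite inE => sE _ s2.
  have [|t ->] := ord_factor (r := s) (@last_face_inj k L); last by rewrite ux.
  by rewrite -[_ \subset _]negbK; apply: contra sE; apply: RE s2; apply: mem_supp.
have u'E' m (s : ord_map m M) : act s (u' M (ord_id M)) = u' m s.
  by rewrite -u'E ?inE // ord_comp_id.
exists (u' M (ord_id M)) => [m s sE|s s1 s2].
  by rewrite /represent u'E' u'u.
by rewrite u'E'; apply: u'_thin; rewrite ?inE.
Qed.

End JoinSteps.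

(** ** Composites and equivalences *)

Lemma thin_faces (Z : scSet) (x : Z 2) : thin x ->
  forall t : ord_map 2 2, thin (act t x).
Proof.
move=> x_thin t.
have [t012|/degenerate_triangle] := boolP (t (inord 0) < t (inord 1) < t (inord 2));
  last by move/(_ _ x)/thin_degenerate.
suff -> : t = ord_id 2 by rewrite act_id.
apply: verts_inj; rewrite !verts_triangle !ffunE !inordK //.
have := ltn_ord (t (inord 2)); move: t012 => /andP[].
move: (t _ : nat) (t _ : nat) (t _ : nat) => p q r pq qr r3.
by congr [:: _; _; _]; lia.
Qed.

(** Decides a propositional assertion about the vertices of S, given that a
    face containing J touches it. *)
Ltac by_cases S :=
  move: (introT implyP (@J_touches _ _ S)); move: (touches S) (_ \subset S);
  do ?move: (_ \in S); clear;
  repeat match goal with |- forall b : bool, _ => case end; move=> //=.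

Section Cartesian.
Variables (X Y : scSet) (f : scMap X Y).
Hypothesis f_thin : detects_thin f.
Hypothesis f_lift :
  forall n i, 0 < i < n -> has_lifting (C := scSetCat) (sc_inner_horn n i) f.
Hypothesis Y_ext :
  forall n i, 0 < i < n -> has_extension (C := scSetCat) (sc_inner_horn n i) Y.

Lemma chord_verts L c : 0 < c <= L -> verts (chord L c) = [:: 0; c].
Proof. by move=> cL; rewrite verts_edge !chordE // !inordK // mul0n mul1n. Qed.

(** The extension in X passes from the faces lacking E0, where the data are
    given, to those lacking E1, ..., E4 in turn.  Lacking E1 are the join of
    the boundary of J with the triangle and J * {c}; E2 adds J * {b, c}, E3
    adds J * {a, b}, and E4 the rest. *)
Lemma compose_strongly_cartesian (x : X 2) : thin x ->
  (forall e : ord_map 1 2, verts e = [:: 0; 1] -> right_fills f (@thin_last Y) (act e x)) ->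
  (forall e : ord_map 1 2, verts e = [:: 1; 2] -> strongly_cartesian f (act e x)) ->
  strongly_cartesian f (act (chord 2 2) x).
Proof.
move=> x_thin x01 x12 [|[|k]] // w y _ wy we _.
pose a : 'I_(k.+1 + 2).+1 := inord k.+1; pose b : 'I_(k.+1 + 2).+1 := inord k.+2.
pose c : 'I_(k.+1 + 2).+1 := inord k.+3.
have [aE [bE cE]] : a = k.+1 :> nat /\ b = k.+2 :> nat /\ c = k.+3 :> nat.
  by split; [|split]; rewrite inordK //; lia.
have neq : ((a == b) = false) * ((b == a) = false) * ((a == c) = false) *
    ((c == a) = false) * ((b == c) = false) * ((c == b) = false).
  by do ![split]; rewrite -val_eqE /= ?aE ?bE ?cE; lia.
have chord_join_sub (S : {set 'I_(k.+1 + 2).+1}) : (S \subset supp (chord_join k 2 2)) = (b \notin S).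
  apply/subsetP/idP => [Sd|bS z zS].
    by apply/negP => /Sd; rewrite mem_chord_join // bE; lia.
  rewrite mem_chord_join //; case: (eqVneq z b) => [zb|zb]; first by rewrite zb (negbTE bS) in zS.
  have := ltn_ord z; move: zb; rewrite -val_eqE /= bE; lia.
pose EB (S : {set 'I_(k.+1 + 2).+1}) := (b \in S) && touches S.
pose E0 (S : {set 'I_(k.+1 + 2).+1}) := ((b \in S) || (J k 2 \subset S) && (a \in S)) && touches S.
pose E1 (S : {set 'I_(k.+1 + 2).+1}) := (J k 2 \subset S) && ((a \in S) || (b \in S)).
pose E2 (S : {set 'I_(k.+1 + 2).+1}) := (J k 2 \subset S) && (a \in S).
pose E3 (S : {set 'I_(k.+1 + 2).+1}) := [&& J k 2 \subset S, a \in S & c \in S].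
pose E4 (S : {set 'I_(k.+1 + 2).+1}) := false.
have HE : horn_complex k 2 2 = lacking E0.
  by apply/setP=> S; rewrite !inE chord_join_sub /E0 -/a; by_cases S.
have BE : base_complex k 2 2 = lacking EB.
  by apply/setP=> S; rewrite !inE chord_join_sub /EB; by_cases S.
have [ka [kb kc]] : k < a /\ k < b /\ k < c by rewrite aE bE cE; lia.
have stepB : step_at a EB E4.
  split=> //; rewrite /EB /E4; prove_upward; first by move=> S; by_cases S.
  by move=> S; rewrite touches_setD1 // !inE !neq; by_cases S.
have step1 : step_at a E0 E1.
  split=> //; rewrite /E0 /E1; prove_upward; first by move=> S; by_cases S.
  by move=> S; rewrite touches_setD1 // J_setU1 // J_setD1 // !inE !neq eqxx; by_cases S.
have step2 : step_at c E1 E2.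
  split=> //; rewrite /E1 /E2; prove_upward; first by move=> S; by_cases S.
  by move=> S; rewrite J_setU1 // J_setD1 // !inE !neq; by_cases S.
have step3 : step_at b E2 E3.
  split=> //; rewrite /E2 /E3; prove_upward; first by move=> S; by_cases S.
  by move=> S; rewrite J_setU1 // J_setD1 // !inE !neq; by_cases S.
have step4 : step_at b E3 E4.
  split=> //; rewrite /E3 /E4; prove_upward; first by move=> S; by_cases S.
  by move=> S; rewrite J_setD1 // !inE !neq; by_cases S.
pose C (v : Y (k.+1 + 2)) := forall s : ord_map 2 (k.+1 + 2),
  s (inord 1) = a -> s (inord 2) \in [set b] -> thin (act s v).
have inner_b (S : {set 'I_(k.+1 + 2).+1}) (s : ord_map 2 _) : a \in S ->
    between S b s -> s = last_face k 2.
  move=> aS [s0S s1 s2S /andP[s0b bs2] s_next].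
  have := s_next a aS; rewrite aE bE ltnSn => -[/(_ isT) as0 _].
  apply: verts_inj; rewrite !verts_triangle !last_faceE !inordK // s1 bE.
  have := ltn_ord (s (inord 2)); rewrite bE in s0b bs2.
  by move=> s2M; congr [:: _; _; _]; lia.
apply: (@join_filler k 2 2 isT X Y f C w y x (lacking E4)) => //.
- by apply: we; apply: verts_last_edge.
- by apply/subsetP=> S _; rewrite inE.
- by rewrite inE.
(* In the base, the inner horns at a make every {j, a, b} thin. *)
- move=> u; rewrite BE => uE _ ux.
  apply: (base_step Y_ext (x := f 2 x) (R := [set b]) stepB) uE _ _ => [S|S z|S z||t].
  + by case/andP=> bS _ _; exists b; rewrite ?bE ?aE.
  + move=> /andP[bS _] zS az /(_ b bS); rewrite aE bE in az * => /(_ (ltnSn _)) zb.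
    by rewrite inE -val_eqE /= bE; lia.
  + by move=> zS; rewrite inE => /eqP zb St; rewrite /EB -zb zS.
  + by move=> m t; rewrite ux app_act.
  + by rewrite -app_act; apply: sc_map_thin; apply: thin_faces.
move=> u v vC; rewrite HE => uE vd vt ux.
have lift0 : partial_lift f v x u (lacking E0) E0 u by split.
have [||u1 lift1] := inner_step f_thin f_lift step1 _ _ lift0.
- move=> S; rewrite /E0 /E1 => E0S E1S aS; exists b; rewrite ?aE ?bE //.
  by move: E0S E1S; rewrite aS; by_cases S.
- move=> S s; rewrite /E0 /E1 => E0S E1S [s0S s1 s2S /andP[_ as2] s_next].
  have bS : b \in S by move: E0S E1S; by_cases S.
  apply: vC => //; have [_] := s_next b bS; rewrite aE bE in as2 * => /(_ (ltnSn _)) s2b.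
  by rewrite inE -val_eqE /= bE; lia.
(* J * {b, c}: a right horn ending in bc. *)
have [|u2 lift2] := right_step step2 _ lift1.
  move=> S; rewrite /E1 /E2 => E1S E2S cS; split.
  - by move=> z zS; rewrite cE -ltnS; have := ltn_ord z; lia.
  - by exists b; rewrite ?kb ?bE ?cE //; move: E1S E2S; by_cases S.
  move=> p e pS /andP[kp pc] p_last eE; left; apply: x12; rewrite eE.
  have [aS bS] : a \notin S /\ b \in S by move: E1S E2S; by_cases S.
  have := p_last b bS; rewrite bE cE ltnSn => /(_ isT) bp.
  by rewrite cE in pc; congr [:: _; _]; lia.
(* J * {a, b}: a right horn ending in ab, whose {0, a, b} is thin. *)
have [|u3 lift3] := right_step step3 _ lift2.
  move=> S; rewrite /E2 /E3 => E2S E3S bS.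
  have [aS cS] : a \in S /\ c \notin S by move: E2S E3S; by_cases S.
  split.
  - move=> z zS; have : z != c by apply: contraNneq cS => <-.
    by rewrite -val_eqE /= bE cE; have := ltn_ord z; lia.
  - by exists a => //; rewrite aE bE; lia.
  move=> p e pS /andP[kp pb] p_last eE; right; split.
    by apply: x01; rewrite eE; rewrite bE in pb *; congr [:: _; _]; lia.
  move=> t t1 t2; apply: vC; rewrite ?t2 ?inE // t1; apply: val_inj.
  by rewrite /= aE; rewrite bE in pb; lia.
(* J * {a, b, c}: an inner horn at b, with abc thin. *)
have [||u4 [lift4 _ u4u _]] := inner_step f_thin f_lift step4 _ _ lift3.
- move=> S; rewrite /E3 => E3S _ _; exists c; rewrite ?bE ?cE //.
  by move: E3S; by_cases S.
- move=> S s; rewrite /E3 => E3S _ /inner_b-> //; last by move: E3S; by_cases S.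
  by rewrite vt; apply: sc_map_thin.
by exists u4.
Qed.

(** The edge ab is an equivalence when ac and bd are degenerate; lifts along
    it are built from lifts along ac and bd.  The stages are as in
    compose_strongly_cartesian.  Lacking E1 are the join of the boundary of J
    with the 3-simplex and J * {b, c, d}; E2 adds J * {a, c}, which provides
    J * {a}; E3 adds J * {a, c, d} and with it J * {a, d}; and lifting this
    along bd, E4 adds J * {a, b, d} and with it J * {a, b}. *)
Lemma equivalence_strongly_cartesian (x : X 3) :
  (forall t : ord_map 2 3, thin (act t x)) ->
  (forall e : ord_map 1 3, verts e = [:: 0; 2] -> strongly_cartesian f (act e x)) ->
  (forall e : ord_map 1 3, verts e = [:: 1; 3] -> strongly_cartesian f (act e x)) ->
  strongly_cartesian f (act (chord 3 1) x).
Proof.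
move=> x_thin x02 x13 [|[|k]] // w y _ wy we _.
pose a : 'I_(k.+1 + 3).+1 := inord k.+1; pose b : 'I_(k.+1 + 3).+1 := inord k.+2.
pose c : 'I_(k.+1 + 3).+1 := inord k.+3; pose d : 'I_(k.+1 + 3).+1 := inord k.+4.
have [aE [bE [cE dE]]] :
    a = k.+1 :> nat /\ b = k.+2 :> nat /\ c = k.+3 :> nat /\ d = k.+4 :> nat.
  by do ?split; rewrite inordK //; lia.
have neq : ((a == b) = false) * ((b == a) = false) * ((a == c) = false) *
    ((c == a) = false) * ((b == c) = false) * ((c == b) = false) *
    ((a == d) = false) * ((d == a) = false) * ((b == d) = false) *
    ((d == b) = false) * ((c == d) = false) * ((d == c) = false).
  by do ![split]; rewrite -val_eqE /= ?aE ?bE ?cE ?dE; lia.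
have chord_join_sub (S : {set 'I_(k.+1 + 3).+1}) :
    (S \subset supp (chord_join k 3 1)) = (c \notin S) && (d \notin S).
  apply/subsetP/andP => [Sd|[cS dS] z zS].
    by split; apply/negP => /Sd; rewrite mem_chord_join // ?cE ?dE; lia.
  rewrite mem_chord_join //; have : z != c by apply: contraNneq cS => <-.
  have : z != d by apply: contraNneq dS => <-.
  by have := ltn_ord z; rewrite -!val_eqE /= cE dE; lia.
pose EB (S : {set 'I_(k.+1 + 3).+1}) := ((c \in S) || (d \in S)) && touches S.
pose E0 (S : {set 'I_(k.+1 + 3).+1}) :=
  ((c \in S) || (d \in S) || (J k 3 \subset S) && (a \in S)) && touches S.
pose E1 (S : {set 'I_(k.+1 + 3).+1}) := (J k 3 \subset S) && (a \in S).
pose E2 (S : {set 'I_(k.+1 + 3).+1}) := [&& J k 3 \subset S, a \in S & (b \in S) || (d \in S)].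
pose E3 (S : {set 'I_(k.+1 + 3).+1}) := [&& J k 3 \subset S, a \in S & b \in S].
pose E4 (S : {set 'I_(k.+1 + 3).+1}) := [&& J k 3 \subset S, a \in S, b \in S & c \in S].
have HE : horn_complex k 3 1 = lacking E0.
  by apply/setP=> S; rewrite !inE chord_join_sub /E0 -/a; by_cases S.
have BE : base_complex k 3 1 = lacking EB.
  by apply/setP=> S; rewrite !inE chord_join_sub /EB; by_cases S.
have [ka [kb [kc kd]]] : k < a /\ k < b /\ k < c /\ k < d by rewrite aE bE cE dE; lia.
have stepB : step_at b EB (fun=> false).
  split=> //; rewrite /EB; prove_upward; first by move=> S; by_cases S.
  by move=> S; rewrite touches_setD1 // !inE !neq; by_cases S.
have step1 : step_at b E0 E1.
  split=> //; rewrite /E0 /E1; prove_upward; first by move=> S; by_cases S.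
  by move=> S; rewrite touches_setD1 // J_setU1 // J_setD1 // !inE !neq; by_cases S.
have step2 : step_at c E1 E2.
  split=> //; rewrite /E1 /E2; prove_upward; first by move=> S; by_cases S.
  by move=> S; rewrite J_setU1 // J_setD1 // !inE !neq; by_cases S.
have step3 : step_at c E2 E3.
  split=> //; rewrite /E2 /E3; prove_upward; first by move=> S; by_cases S.
  by move=> S; rewrite J_setU1 // J_setD1 // !inE !neq; by_cases S.
have step4 : step_at d E3 E4.
  split=> //; rewrite /E3 /E4; prove_upward; first by move=> S; by_cases S.
  by move=> S; rewrite J_setU1 // J_setD1 // !inE !neq; by_cases S.
have after_b (z : 'I_(k.+1 + 3).+1) : b < z -> z \in [set c; d].
  by rewrite !inE -!val_eqE /= bE cE dE; have := ltn_ord z; lia.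
pose C (v : Y (k.+1 + 3)) := forall s : ord_map 2 (k.+1 + 3),
  s (inord 1) = b -> s (inord 2) \in [set c; d] -> thin (act s v).
apply: (@join_filler k 3 1 isT X Y f C w y x (lacking E4)) => //.
- by apply: we; apply: verts_last_edge.
- by rewrite HE; apply/subsetP=> S; rewrite !inE /E0 /E4; by_cases S.
- rewrite inE; apply/negP; rewrite /E4 => /and4P[_ _ _].
  by rewrite mem_chord_join // cE; lia.
(* In the base, the inner horns at b make {j, b, c} and {j, b, d} thin. *)
- move=> u; rewrite BE => uE _ ux.
  apply: (base_step Y_ext (x := f 3 x) (R := [set c; d]) stepB) uE _ _ => [S|S z|S z||t].
  + case/andP=> /orP[cS|dS] _ _; first by exists c; rewrite // bE cE; lia.
    by exists d; rewrite // bE dE; lia.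
  + by move=> _ _ /after_b.
  + by move=> zS; rewrite !inE /EB => /orP[]/eqP<- ->; rewrite zS ?orbT.
  + by move=> m t; rewrite ux app_act.
  + by rewrite -app_act; apply: sc_map_thin.
move=> u v vC; rewrite HE => uE vd vt ux.
have lift0 : partial_lift f v x u (lacking E0) E0 u by split.
(* All inner horns at b at once, including those of J * {b, c, d}. *)
have [||u1 lift1] := inner_step f_thin f_lift step1 _ _ lift0.
- move=> S; rewrite /E0 /E1 => E0S E1S _.
  have /orP[cS|dS] : (c \in S) || (d \in S) by move: E0S E1S; by_cases S.
    by exists c; rewrite // bE cE; lia.
  by exists d; rewrite // bE dE; lia.
- by move=> S s _ _ [_ s1 _ /andP[_ /after_b s2] _]; apply: vC.
(* J * {a, c}: a right horn ending in ac. *)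
have [|u2 lift2] := right_step step2 _ lift1.
  move=> S; rewrite /E1 /E2 => E1S E2S cS.
  have [aS bS dS] : [/\ a \in S, b \notin S & d \notin S] by move: E1S E2S; by_cases S.
  split.
  - move=> z zS; have : z != d by apply: contraNneq dS => <-.
    by rewrite -val_eqE /= cE dE; have := ltn_ord z; lia.
  - by exists a; rewrite // aE cE; lia.
  move=> p e pS /andP[kp pc] p_last eE; left; apply: x02; rewrite eE.
  have : p != b by apply: contraNneq bS => <-.
  by rewrite -val_eqE /= bE cE in pc * => pb; congr [:: _; _]; lia.
(* J * {a, c, d}: an inner horn at c, with acd thin. *)
have [||u3 lift3] := inner_step f_thin f_lift step3 _ _ lift2.
- move=> S; rewrite /E2 /E3 => E2S E3S _; exists d; last by rewrite cE dE; lia.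
  by move: E2S E3S; by_cases S.
- move=> S s; rewrite /E2 /E3 => E2S E3S [s0S s1 s2S /andP[s0c cs2] s_next].
  have [aS bS] : a \in S /\ b \notin S by move: E2S E3S; by_cases S.
  have [|t ->] := ord_factor (r := s) (@last_face_inj k 3).
    have := s_next a aS; rewrite aE cE => -[/(_ (ltnW (ltnSn _))) as0 _].
    apply/subsetP=> z; rewrite mem_triangle mem_last_face s1 => /or3P[]/eqP-> //.
    by rewrite cE in cs2; lia.
  by rewrite act_comp vt -app_act; apply: sc_map_thin.
(* J * {a, b, d}: a right horn ending in bd. *)
have [|u4 [lift4 _ u4u _]] := right_step step4 _ lift3.
  move=> S; rewrite /E3 /E4 => E3S E4S dS.
  have [bS cS] : b \in S /\ c \notin S by move: E3S E4S; by_cases S.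
  split.
  - by move=> z zS; rewrite dE; have := ltn_ord z; lia.
  - by exists b; rewrite // bE dE; lia.
  move=> p e pS /andP[kp pd] p_last eE; left; apply: x13; rewrite eE.
  have : p != c by apply: contraNneq cS => <-.
  have := p_last b bS; rewrite -val_eqE /= bE cE dE in pd * => /(_ (ltnW (ltnSn _))) bp pc.
  by congr [:: _; _]; lia.
by exists u4.
Qed.

End Cartesian.

(** * Extension problems over the base *)

Lemma over_extension (B : scSet) (X : msSet) (f : scMap X B) (A A' : msSet)
    (j : msMap A A') (p : scMap A' B) :
  has_extension (over_gen j p : hom (c := msOverCat B) _ _) (MsOver f) <->
  (forall u : msMap A X, scMap_comp f u = scMap_comp p j ->
    exists h : msMap A' X, msMap_comp h j = u /\ scMap_comp f h = p).
Proof.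
split=> [ext u fu|ext u].
  have [h hj] := ext (@OverMap _ (MsOver (scMap_comp p j)) (MsOver f) u fu).
  exists h; split; last exact: over_map_str h.
  exact: (congr1 (fun g : overMap _ _ => over_map g) hj).
have [h [hj fh]] := ext u (over_map_str u).
exists (@OverMap _ (MsOver p) (MsOver f) h fh).
exact: overMap_eq.
Qed.

Section MsMaps.
Variable X : msSet.

Lemma ms_map_subproof (A : sSet) (E : A 1 -> Prop) (g : sMap A X)
    (gE : forall e, E e -> marked (g 1 e)) (e : A 1) :
  degenerate e \/ E e -> marked (g 1 e).
Proof. by case=> [/(degenerate_map g)/marked_degenerate|/gE]. Qed.

Definition marked_scaled_map (A : sSet) (E : A 1 -> Prop) (T : A 2 -> Prop)
    (g : sMap A X) (gE : forall e, E e -> marked (g 1 e))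
    (gT : forall t, T t -> thin (g 2 t)) : msMap (marked_scaled E T) X :=
  @MsMap (marked_scaled E T) X (scaled_map gT) (ms_map_subproof gE).

End MsMaps.

Lemma scaled_lifting (X Y : scSet) (f : scMap X Y) (A A' : sSet)
    (j : sMap A A') (T : A' 2 -> Prop) : detects_thin f ->
  has_lifting (C := sSetCat) j (sc_map f) ->
  has_lifting (C := scSetCat) (sc_restrict j T) f.
Proof.
move=> f_thin f_lift u v uv.
have [h [hu hv]] := f_lift (sc_map u) (sc_map v) (congr1 (fun g : scMap _ _ => sc_map g) uv).
have hT t : T t -> thin (app h t).
  move=> tT; apply/f_thin; rewrite -[f 2 _]/(sMap_comp f h 2 t) (sMap_app hv).
  by apply: (@sc_map_thin (scaled _) _ v); right.
exists (@scaled_map _ T X h hT); split; apply: scMap_eq.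
  exact: hu.
exact: hv.
Qed.

Lemma face_const (X : sSet) n p q (e : ord_map 1 n) (x : X n) (z : X 0) :
  p < q -> verts e = [:: p; q] -> act e x = act (ord_const 1 ord0) z ->
  forall m (s : Delta n m), face n [:: p; q] m s ->
    act s x = act (ord_const m ord0) z.
Proof.
move=> pq eE ez m s /verts_face sI.
have e_inj : injective e.
  move: eE; rewrite verts_edge => -[e0 e1] i j ij.
  apply: contraTeq pq; rewrite -val_eqE /= -leqNgt -e0 -e1 => ne.
  have [ij1|ij1] := ltnP i j.
    have -> : inord 1 = j by apply: val_inj; rewrite /= inordK //; have := ltn_ord j; lia.
    have -> : inord 0 = i by apply: val_inj; rewrite /= inordK //; have := ltn_ord j; lia.
    by rewrite ij.
  have -> : inord 1 = i by apply: val_inj; rewrite /= inordK //; have := ltn_ord i; lia.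
  have -> : inord 0 = j by apply: val_inj; rewrite /= inordK //; have := ltn_ord i; lia.
  by rewrite ij.
have [|t ->] := ord_factor (r := s) e_inj.
  by apply/subsetP=> y /sI; rewrite -mem_verts eE.
by rewrite act_comp ez -act_comp; congr (act _ z); apply: ord_map0.
Qed.

(** A 3-simplex with degenerate edges 02 and 13 factors through Q. *)
Section QMap.
Variables (X : sSet) (x : X 3) (z z' : X 0) (e e' : ord_map 1 3).
Hypotheses (eE : verts e = [:: 0; 2]) (e'E : verts e' = [:: 1; 3]).
Hypotheses (ez : act e x = act (ord_const 1 ord0) z)
  (ez' : act e' x = act (ord_const 1 ord0) z').

Lemma Q_map02 n (a : sub_sSet (face 3 [:: 0; 2]) n) :
  yoneda x n (incl _ n a) = yoneda z n (to_Delta0 _ n a).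
Proof. exact: (@face_const X 3 0 2 e x z isT eE ez n (sval a) (svalP a)). Qed.

Lemma Q_map13 n (a : sub_sSet (face 3 [:: 1; 3]) n) :
  po_elim Q_map02 n (Q_attach n a) = yoneda z' n (to_Delta0 _ n a).
Proof.
rewrite [LHS](po_elim_inl Q_map02).
exact: (@face_const X 3 1 3 e' x z' isT e'E ez' n (sval a) (svalP a)).
Qed.

Definition Q_map : sMap Qsset X := po_elim Q_map13.

Lemma Q_mapE n (s : Delta 3 n) : Q_map n (to_Q n s) = act s x.
Proof. by rewrite [LHS](po_elim_inl Q_map13) [LHS](po_elim_inl Q_map02). Qed.

Lemma Q_map_simplex n (q : Qsset n) : 0 < n ->
  degenerate (Q_map n q) \/ exists s, Q_map n q = act s x.
Proof.
move=> n0.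
have deg (y : X 0) (t : ord_map n 0) : degenerate (act t y) by exists 0, t, y.
rewrite -[q]po_reprK; case: po_repr => [q'|c]; last first.
  by left; rewrite [Q_map _ _](po_elim_inr Q_map13); apply: deg.
rewrite [Q_map _ _](po_elim_inl Q_map13) -[q']po_reprK; case: po_repr => [s|c].
  by right; exists s; rewrite [LHS](po_elim_inl Q_map02).
by left; rewrite [po_elim _ _ _](po_elim_inr Q_map02); apply: deg.
Qed.

End QMap.

Lemma to_Q_degenerate (e : ord_map 1 3) :
  verts e = [:: 0; 2] \/ verts e = [:: 1; 3] -> degenerate (to_Q 1 e).
Proof.
case=> eE.
  have eF : face 3 [:: 0; 2] 1 e by move=> i; rewrite eE.
  have -> : to_Q 1 e = sMap_comp (po_inl Q_attach (to_Delta0 _)) (po_inr _ _) 1 (ord_const 1 ord0).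
    congr (po_inl _ _ 1 _); apply/po_classP/Relation_Operators.rst_step.
    by exists (exist _ (e : Delta 3 1) eF).
  by apply: degenerate_map; exists 0, (ord_const 1 ord0), (ord_id 0); split=> //; rewrite /= ord_comp_id.
have eF : face 3 [:: 1; 3] 1 e by move=> i; rewrite eE.
have -> : to_Q 1 e = po_inr Q_attach (to_Delta0 _) 1 (ord_const 1 ord0).
  apply/po_classP/Relation_Operators.rst_step.
  by exists (exist _ (e : Delta 3 1) eF).
by apply: degenerate_map; exists 0, (ord_const 1 ord0), (ord_id 0); split=> //; rewrite /= ord_comp_id.
Qed.

(** * Simplices given by their lists of vertices *)

Definition lmap m n (l : seq nat) : ord_map m n := omap m n (nth 0 l).

Lemma verts_lmap m n (l : seq nat) :
  [&& sorted leq l, size l == m.+1 & all (leq^~ n) l] -> verts (lmap m n l) = l.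
Proof.
case/and3P=> l_sort /eqP lm /seq.allP ln.
rewrite vertsE; apply: (@eq_from_nth _ 0); rewrite size_mkseq // => i im.
rewrite nth_mkseq // omapE ?inordK // => [j jm|j k /andP[jk km]].
  by apply: ln; rewrite mem_nth // lm ltnS.
by apply: (sorted_leq_nth leq_trans leqnn) => //; rewrite inE lm ltnS // (leq_trans jk).
Qed.

Lemma verts_comp_nth l m n (s : ord_map m n) (t : ord_map l m) :
  verts (ord_comp s t) = [seq nth 0 (verts s) i | i <- verts t].
Proof.
rewrite [verts t]vertsE /mkseq -map_comp vertsE; apply: eq_map => i /=.
by rewrite vertsE nth_mkseq // ord_compE inord_val.
Qed.

Lemma act_verts (X : sSet) k l n (x : X n) (s : ord_map k n) (t : ord_map l k) (r : ord_map l n) :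
  [seq nth 0 (verts s) i | i <- verts t] = verts r -> act t (act s x) = act r x.
Proof.
by rewrite -verts_comp_nth -act_comp => /verts_inj->.
Qed.

Lemma verts_injective m n (s : ord_map m n) : uniq (verts s) -> injective s.
Proof.
rewrite vertsE => /(uniqP 0) s_uniq i j ij; apply: val_inj => /=.
by apply: s_uniq; rewrite ?inE ?size_mkseq // !nth_mkseq // !inord_val ij.
Qed.

Lemma verts_id1 : verts (ord_id 1) = [:: 0; 1].
Proof. by rewrite verts_edge !ffunE !inordK. Qed.

Lemma verts_const m n (j : 'I_n.+1) : verts (ord_const m j) = nseq m.+1 (j : nat).
Proof.
apply: (@eq_from_nth _ 0); rewrite vertsE size_mkseq ?size_nseq // => i im.
by rewrite nth_mkseq // nth_nseq im ffunE.
Qed.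

Lemma const_degenerate (X : sSet) m n (x : X n) (s : ord_map m n) j : 0 < m ->
  verts s = nseq m.+1 j -> degenerate (act s x).
Proof.
move=> m0 sE; exists 0, (ord_const m ord0), (act (ord_const 0 (s ord0)) x).
split=> //; rewrite -act_comp; congr (act _ x); apply: ord_map_eq => i.
rewrite ord_compE [RHS]ffunE; apply: val_inj.
have vE k : val (s k) = j.
  have : val (s k) \in verts s by rewrite mem_verts mem_supp.
  by rewrite sE mem_nseq => /andP[_ /eqP].
by rewrite !vE.
Qed.

Lemma degenerate_of_edge (X : sSet) m (e : X 1) (s : ord_map m 1) :
  1 < m -> degenerate (act s e).
Proof. by exists 1, s, e. Qed.

(** * Outer cartesian fibrations lift against the generators *)

Section FromFibration.
Variables (B : scSet) (X : msSet) (f : scMap X B).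
Hypotheses (hB : infty_bicategory B) (f_thin : detects_thin f).
Hypothesis f_fib : outer_cartesian_fibration f.
Hypothesis f_marked : forall e : X 1, marked e <-> cartesian f e.

Let f_outer : outer_fibration f := proj1 f_fib.

Let f_inner n i : 0 < i < n -> has_lifting (C := scSetCat) (sc_inner_horn n i) f.
Proof. by case: f_outer => [[H _ _] _ _ _]; apply: H. Qed.

Let B_inner n i : 0 < i < n -> has_extension (C := scSetCat) (sc_inner_horn n i) B.
Proof. by case: hB => H _ _; apply: H. Qed.

(** Up to a degenerate triangle, e is e followed by an identity, and
    identities are strongly cartesian. *)
Lemma cartesian_strongly_cartesian (e : X 1) : cartesian f e -> strongly_cartesian f e.
Proof.
move=> eC; pose s := lmap 2 1 [:: 0; 1; 1].
have sE : verts s = [:: 0; 1; 1] by apply: verts_lmap.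
have se (d : ord_map 1 2) : verts d = [:: 0; 1] \/ verts d = [:: 0; 2] -> act d (act s e) = e.
  move=> dE; rewrite -[RHS]act_id; apply: act_verts.
  by rewrite sE verts_id1; case: dE => ->.
rewrite -(se (chord 2 2)); last by right; apply: chord_verts.
apply: (compose_strongly_cartesian f_thin f_inner B_inner) => [|d dE|d dE].
- by apply/thin_degenerate/degenerate_of_edge.
- by rewrite se; [apply: cartesian_fills | left].
apply: degenerate_strongly_cartesian => //; rewrite -act_comp.
by apply: (@const_degenerate _ _ _ _ _ 1) => //; rewrite verts_comp_nth sE dE.
Qed.

Lemma marked_strongly_cartesian (e : X 1) : marked e -> strongly_cartesian f e.
Proof. by move/f_marked; apply: cartesian_strongly_cartesian. Qed.

Lemma lift_inner n i (p : scMap (scaled (@inner_scaling n i)) B) : 0 < i < n ->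
  has_extension (over_gen (ms_inner_horn n i) p : hom (c := msOverCat B) _ _) (MsOver f).
Proof.
move=> i_inner; apply/over_extension => u fu.
have [h [hu fh]] := f_inner i_inner fu.
have hE e : noneP e -> marked (app h e) by [].
have hT t : @inner_scaling n i t -> thin (app h t).
  by move=> tT; apply: (@sc_map_thin (scaled _) _ h); right.
exists (@marked_scaled_map X _ noneP _ (sc_map h) hE hT); split.
  by apply: msMap_eq; rewrite -hu; apply: scMap_eq.
by rewrite -fh; apply: scMap_eq.
Qed.

(** For n = 1 the horn is a point, and the filler is a cartesian lift; for
    larger n the last edge is marked, hence strongly cartesian. *)
Lemma lift_right n (p : scMap (scaled (@noneP (Delta n 2))) B) : 1 <= n ->
  has_extension (over_gen (ms_right_horn n) p : hom (c := msOverCat B) _ _) (MsOver f).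
Proof.
move=> n0; apply/over_extension => u fu.
have [w [wH wu]] := @horn_pmap X n ord_max u n0.
have up m (s : ord_map m n) (sH : horn n n m s) : f m (w m s) = act s (p n (ord_id n)).
  by rewrite (wu m (exist _ s sH)) -yonedaE; apply: (scMap_app fu (exist _ s sH)).
have [x [fx xw x_marked]] : exists x : X n, [/\ f n x = p n (ord_id n),
    agree_on (hornc ord_max) (represent x) w & marked (act (last_edge n) x)].
  case: n n0 p u fu w wH wu up => [|[|n]] // _ p u fu w wH wu up.
    have v_const m (s : ord_map m 1) : supp s \in hornc ord_max -> s = ord_const m ord_max.
      case/horncP=> j [j1 js]; apply: ord_map_eq => i; rewrite ffunE.
      apply/eqP; apply: contraR js => si; apply/suppP; exists i.
      by apply: val_inj; move: si j1; rewrite -!val_eqE /=; case: (s i) j => [[|[|?]] ?] [[|[|?]] ?].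
    have vH m : supp (ord_const m (@ord_max 1)) \in hornc ord_max.
      apply/horncP; exists ord0; split=> //; apply/suppP => -[i].
      by rewrite ffunE => /(congr1 val).
    have := (proj2 f_fib) (w 0 (ord_const 0 ord_max)) (p 1 (ord_id 1)).
    case; first by rewrite up //; apply/(hornE (@ord_max 1)).
    move=> e [fe e_target eC]; exists e; split=> //.
      move=> m s /v_const->; rewrite /represent.
      have cE : ord_const m (@ord_max 1) = ord_comp (ord_const 0 ord_max) (ord_const m ord0).
        by apply: ord_map_eq => i; rewrite ord_compE !ffunE.
      by rewrite cE wH // act_comp; congr (act _ _).
    rewrite (_ : last_edge 1 = ord_id 1) ?act_id; first exact/f_marked.
    by apply: verts_inj; rewrite verts_last_edge // verts_id1.
  have eH := @last_edge_horn n.+2 isT.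
  have e_marked : marked (w 1 (last_edge n.+2)).
    have eH' : horn n.+2 n.+2 1 (last_edge n.+2) by apply/(hornE (@ord_max n.+2)).
    rewrite (wu 1 (exist _ _ eH')); apply: (@ms_map_marked (marked_scaled _ _) _ u).
    by right; rewrite /simp_of inE /= verts_last_edge.
  have [|s sE|x [fx xw]] := marked_strongly_cartesian e_marked (w := w) (y := p _ (ord_id _)) isT _ _ I.
  - by split=> // m s sH; apply: up; apply/(hornE (@ord_max n.+2)).
  - by congr (w 1 _); apply: verts_inj; rewrite sE verts_last_edge.
  by exists x; split=> //; rewrite -[act _ x]/(represent x (last_edge n.+2)) xw.
have xE (e : Delta n 1) : simp_of [:: [:: n.-1; n]] e -> marked (yoneda x 1 e).
  rewrite /simp_of inE -verts_last_edge // => /eqP/verts_inj->; exact: x_marked.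
have xT (t : Delta n 2) : noneP t -> thin (yoneda x 2 t) by [].
exists (marked_scaled_map xE xT); split.
  apply: msMap_eq; apply: scMap_eq; apply: sMap_eq => m s.
  by rewrite -[RHS]wu; apply: xw; apply/(hornE (@ord_max n))/svalP.
apply: scMap_eq; apply: sMap_eq => m s /=.
by rewrite app_act fx -yonedaE.
Qed.

Lemma lift_left n (p : scMap (scaled (@noneP (collapse (face n [:: 0; 1]) 2))) B) : 2 <= n ->
  has_extension (over_gen (ms_collapsed_horn n) p : hom (c := msOverCat B) _ _) (MsOver f).
Proof.
move=> n2; apply/over_extension => u fu.
have [_ _ f_left _] := f_outer.
have [h [hu fh]] := f_left n n2 (sc_map u) (sc_map p) (congr1 (fun g : scMap _ _ => sc_map g) fu).
have hE e : noneP e -> marked (app h e) by [].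
have hT t : noneP t -> thin (app h t) by [].
exists (@marked_scaled_map X _ noneP noneP h hE hT).
by split; [apply: msMap_eq|]; apply: scMap_eq.
Qed.

Section Widen.
Variables (A : sSet) (E E' : A 1 -> Prop) (T T' : A 2 -> Prop).
Variables (EE' : forall e, E e -> E' e) (TT' : forall t, T t -> T' t).
Variable p : scMap (scaled T') B.

(** These generators are identities on underlying simplicial sets, and thinness
    is detected in the base; so the only question is which edges of X have to
    be marked. *)
Lemma lift_widen :
  (forall g : sMap A X, (forall e, E e -> marked (g 1 e)) -> (forall t, T t -> thin (g 2 t)) ->
     (forall t, T' t -> thin (g 2 t)) -> forall e, E' e -> marked (g 1 e)) ->
  has_extension (over_gen (ms_widen EE' TT') p : hom (c := msOverCat B) _ _) (MsOver f).
Proof.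
move=> gE'; apply/over_extension => u fu.
have uE e : E e -> marked (u 1 e) by move=> eE; apply: (@ms_map_marked (marked_scaled _ _)); right.
have uT t : T t -> thin (u 2 t) by move=> tT; apply: (@sc_map_thin (scaled _)); right.
have uT' t : T' t -> thin (u 2 t).
  move=> tT; apply/f_thin; rewrite -[f 2 _]/(scMap_comp f u 2 t) fu.
  by apply: (@sc_map_thin (scaled _) _ p); right.
exists (marked_scaled_map (gE' _ uE uT uT') uT'); split.
  by apply: msMap_eq; apply: scMap_eq; apply: sMap_eq.
apply: scMap_eq; apply: sMap_eq => m a.
exact: (scMap_app fu a).
Qed.

End Widen.

Lemma lift_generator (A A' : msOverCat B) (j : hom A A') :
  anodyne_generator j -> has_extension j (MsOver f : msOverCat B).
Proof.
case=> [n i p|n p|n p|p|p|p].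
- exact: lift_inner.
- exact: lift_right.
- exact: lift_left.
- by apply: lift_widen => g _ _ _ e.
- apply: lift_widen => g _ gT _ _ [s sE ->].
  pose x := g 3 (to_Q 3 (ord_id 3)).
  have gx n (t : Delta 3 n) : g n (to_Q n t) = act t x.
    exact: (@yonedaE X 3 (sMap_comp g to_Q) n t).
  have x_thin (t : ord_map 2 3) : thin (act t x) by rewrite -gx; apply: gT.
  have x_deg (d : ord_map 1 3) : verts d = [:: 0; 2] \/ verts d = [:: 1; 3] ->
      strongly_cartesian f (act d x).
    move=> dE; apply: degenerate_strongly_cartesian => //; rewrite -gx.
    by apply: degenerate_map; apply: to_Q_degenerate.
  have x01 : strongly_cartesian f (act (chord 3 1) x).
    by apply: (equivalence_strongly_cartesian f_thin f_inner B_inner) => // d dE; apply: x_deg; [left|right].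
  rewrite gx; apply/f_marked/strongly_cartesian_cartesian => //.
  move: sE; rewrite /simp_of !inE => /orP[]/eqP sE.
    by rewrite (_ : s = chord 3 1) //; apply: verts_inj; rewrite sE chord_verts.
  (* The edge 03 is the composite of 01 and the degenerate edge 13. *)
  pose t := lmap 2 3 [:: 0; 1; 3].
  have tE : verts t = [:: 0; 1; 3] by apply: verts_lmap.
  rewrite -(@act_verts _ _ _ _ x t (chord 2 2) s); last by rewrite tE chord_verts.
  apply: (compose_strongly_cartesian f_thin f_inner B_inner) => [//|d dE|d dE].
    rewrite (@act_verts _ _ _ _ x t d (chord 3 1)); last by rewrite tE dE chord_verts.
    exact: strongly_cartesian_fills.
  by rewrite -act_comp; apply: x_deg; right; rewrite verts_comp_nth tE dE.
- apply: lift_widen => g gE gT _ e _.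
  pose x := g 2 (ord_id 2).
  have gx n (t : Delta 2 n) : g n t = act t x by apply: (@yonedaE X 2 g n t).
  have x_thin : thin x by apply: gT; rewrite /simp_of inE; apply/eqP; rewrite verts_triangle !ffunE !inordK.
  have x_edge (d : ord_map 1 2) : verts d \in [:: [:: 0; 1]; [:: 1; 2]] ->
      strongly_cartesian f (act d x).
    by move=> dE; apply: marked_strongly_cartesian; rewrite -gx; apply: gE.
  rewrite gx; apply/f_marked/strongly_cartesian_cartesian => //.
  have [e0|e0] := eqVneq (e (inord 0)) (e (inord 1)).
    apply: degenerate_strongly_cartesian => //.
    by apply: (@const_degenerate _ _ _ _ _ (e (inord 0))) => //; rewrite verts_edge -e0.
  have e01 : e (inord 0) < e (inord 1).
    by rewrite ltn_neqAle val_eqE e0 ord_mapP // !inordK.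
  have [eE|eE] := boolP (verts e \in [:: [:: 0; 1]; [:: 1; 2]]); first exact: x_edge.
  have {}eE : verts e = [:: 0; 2].
    move: eE; rewrite verts_edge; move: e01 (ltn_ord (e (inord 1))).
    by move: (e (inord 0) : nat) (e (inord 1) : nat) => [|[|[|?]]] [|[|[|?]]].
  rewrite (_ : e = chord 2 2); last by apply: verts_inj; rewrite eE chord_verts.
  apply: (compose_strongly_cartesian f_thin f_inner B_inner) => [//|d dE|d dE].
    by apply: strongly_cartesian_fills; apply: x_edge; rewrite dE.
  by apply: x_edge; rewrite dE.
Qed.

End FromFibration.

(** * Lifting against the generators gives an outer cartesian fibration *)

Section ToFibration.
Variables (B : scSet) (X : msSet) (f : scMap X B).
Hypothesis f_thin : detects_thin f.
Hypothesis f_lift : forall (A A' : msOverCat B) (j : hom A A'),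
  anodyne_generator j -> has_extension j (MsOver f : msOverCat B).

Lemma inner_lifting n i : 0 < i < n -> has_lifting (C := scSetCat) (sc_inner_horn n i) f.
Proof.
move=> i_inner u v uv.
pose u' := @MsMap (marked_scaled noneP _) X u
  (@ms_map_subproof X _ noneP (sc_map u) (fun e => False_ind _)).
have [|h [hu fh]] := proj1 (over_extension _ _ _) (f_lift (Gen_inner v i_inner)) u'.
  exact: uv.
exists (ms_map h); split=> //.
exact: (congr1 (fun g : msMap _ _ => ms_map g) hu).
Qed.

Lemma left_lifting n : 2 <= n ->
  has_lifting (C := sSetCat) (collapsed_horn n 0 [:: 0; 1]) (sc_map f).
Proof.
move=> n2 u v uv.
pose u' := @marked_scaled_map X _ noneP noneP u (fun e => False_ind _) (fun e => False_ind _).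
pose v' := @scaled_map _ noneP B v (fun e => False_ind _).
have [|h [hu fh]] := proj1 (over_extension _ _ _) (f_lift (Gen_left v' n2)) u'.
  by apply: scMap_eq.
exists (sc_map h); split.
  exact: (congr1 (fun g : msMap _ _ => sc_map g) hu).
exact: (congr1 (fun g : scMap _ _ => sc_map g) fh).
Qed.

Lemma marked_last_edge_filler n (w : pmap n X) (y : B n) : 1 <= n ->
  horn_over f ord_max w y ->
  (forall e, verts e = [:: n.-1; n] -> supp e \in hornc (@ord_max n) -> marked (w 1 e)) ->
  exists x : X n, [/\ f n x = y, agree_on (hornc ord_max) (represent x) w
    & marked (act (last_edge n) x)].
Proof.
move=> n0 [wH wf] w_marked.
have uE (e : Lambda n n 1) : simp_of [:: [:: n.-1; n]] (sval e) ->
    marked (horn_map (i := ord_max) wH 1 e).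
  rewrite /simp_of inE => /eqP eE; apply: w_marked => //.
  by apply/(hornE (@ord_max n))/svalP.
pose u := @marked_scaled_map X _ _ noneP (horn_map (i := ord_max) wH) uE (fun e => False_ind _).
pose v := @scaled_map _ noneP B (yoneda y) (fun e => False_ind _).
have [|h [hu fh]] := proj1 (over_extension _ _ _) (f_lift (Gen_right v n0)) u.
  apply: scMap_eq; apply: sMap_eq => m s; apply: wf.
  by apply/(hornE (@ord_max n))/svalP.
exists (app h (ord_id n : Delta n n)); split.
- by rewrite -[LHS]/(scMap_comp f h n (ord_id n)) fh /= act_id.
- move=> m s sH; have sH' : horn n n m s by apply/(hornE (@ord_max n)).
  rewrite /represent -(yonedaE (sc_map h)).
  exact: (scMap_app (congr1 (fun g : msMap _ _ => ms_map g) hu) (exist _ s sH')).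
rewrite -(yonedaE (sc_map h)); apply: (@ms_map_marked (marked_scaled _ _) _ h).
by right; rewrite /simp_of inE verts_last_edge.
Qed.

Lemma marked_edge_strongly_cartesian (e : X 1) : marked e -> strongly_cartesian f e.
Proof.
move=> e_marked n w y n2 wy we _.
have [|e' /we->//|x [fx xw _]] := marked_last_edge_filler _ wy; first exact: ltnW.
by exists x.
Qed.

Lemma marked_lift (x : X 0) (e : B 1) : target e = f 0 x ->
  exists e' : X 1, [/\ f 1 e' = e, target e' = x & marked e'].
Proof.
move=> ex; pose w : pmap 1 X := fun m s => act (ord_const m ord0) x.
have wE m (s : ord_map m 1) : supp s \in hornc ord_max -> s = ord_const m ord_max.
  case/horncP=> j [j1 js]; apply: ord_map_eq => i; rewrite ffunE.
  apply/eqP; apply: contraR js => si; apply/suppP; exists i.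
  by apply: val_inj; move: si j1; rewrite -!val_eqE /=; case: (s i) j => [[|[|?]] ?] [[|[|?]] ?].
have [|e0|e' [fe' e'w e'_marked]] := @marked_last_edge_filler 1 w e isT.
- split=> [m l s t _|m s /wE->].
    by rewrite /w -act_comp; congr (act _ x); apply: ord_map0.
  rewrite /w app_act -ex /target /endpoint -act_comp; congr (act _ e).
  by apply: ord_map_eq => i; rewrite ord_compE !ffunE.
- by move=> e0E /wE e0c; move: e0E; rewrite e0c verts_const.
exists e'; split=> //.
  have -> : target e' = w 0 (ord_const 0 ord_max).
    apply: e'w; apply/horncP; exists ord0; split=> //; apply/suppP => -[i].
    by rewrite ffunE => /(congr1 val).
  by rewrite /w (ord_map0 (ord_const 0 ord0) (ord_id 0)) act_id.
by move: e'_marked; rewrite (_ : last_edge 1 = ord_id 1) ?act_id //;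
   apply: verts_inj; rewrite verts_last_edge // verts_id1.
Qed.

(** A map out of the collapsed right horn is a map out of the horn with
    degenerate, hence marked, last edge.  The filler of the latter is constant
    on the collapsed edge because the edge lies in the horn. *)
Lemma right_lifting n : 2 <= n ->
  has_lifting (C := sSetCat) (collapsed_horn n n [:: n.-1; n]) (sc_map f).
Proof.
move=> n2 u v uv; pose I := [:: n.-1; n].
pose Kn := preim_subS (horn_incl n n) (face n I).
pose tc : sMap (Lambda n n) (collapse Kn) := to_collapse Kn.
have uvE m (a : collapse Kn m) : f m (app u a) = app v (collapsed_horn n n I m a).
  exact: (sMap_app uv a).
have [w [wH wu]] := @horn_pmap X n ord_max (sMap_comp u tc) (ltnW n2).
pose y := app v (to_collapse (face n I) n (ord_id n)).
pose z := app u (po_inr (incl Kn) (to_Delta0 _) 0 (ord_id 0)).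
have yE m (s : ord_map m n) : act s y = app v (to_collapse (face n I) m s).
  by rewrite -(yonedaE (sMap_comp v (to_collapse (face n I)))).
have uz m : app u (po_inr (incl Kn) (to_Delta0 _) m (ord_const m ord0)) = act (ord_const m ord0) z.
  rewrite -[RHS]app_act -app_act; congr (app u (po_inr _ _ _ _)).
  exact: ord_map0.
have w_face m (s : ord_map m n) : horn n n m s -> face n I m s -> w m s = act (ord_const m ord0) z.
  move=> sH sI; rewrite (wu m (exist _ s sH)) -uz; congr (app u _).
  apply/po_classP/Relation_Operators.rst_step.
  by exists (exist (Kn m) (exist _ s sH) sI).
have wy : horn_over f ord_max w y.
  split=> // m s sH; have sH' : horn n n m s by apply/(hornE (@ord_max n)).
  rewrite (wu m (exist _ s sH')) yE [LHS]uvE; congr (app v _).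
  exact: collapsed_horn_inl.
have [|e eE eH|x [fx xw _]] := marked_last_edge_filler _ wy; first exact: ltnW.
  rewrite w_face; [|exact/(hornE (@ord_max n))|by move=> i; rewrite eE].
  by apply: marked_degenerate; apply/degenerate_edge; exists z.
have face_horn m (s : ord_map m n) : face n I m s -> horn n n m s.
  move=> /verts_face sI; apply/(hornE (@ord_max n))/horncP; exists ord0; split.
    by rewrite -val_eqE /=; lia.
  by apply/negP => /sI; rewrite !inE /=; lia.
have hE m (a : sub_sSet (face n I) m) : yoneda x m (incl _ m a) = yoneda z m (to_Delta0 _ m a).
  have aH := face_horn m (sval a) (svalP a).
  rewrite /= -[LHS]/(represent x (sval a)) xw ?w_face //; first exact: svalP a.
  exact/(hornE (@ord_max n)).
exists (po_elim hE); split; apply: po_ext => m a.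
- rewrite -[LHS]/(po_elim hE m (collapsed_horn n n I m (tc m a))).
  rewrite collapsed_horn_inl [LHS]po_elim_inl -[RHS]/(sMap_comp u tc m a) -wu.
  by apply: xw; apply/(hornE (@ord_max n))/svalP.
- rewrite -[LHS]/(po_elim hE m (collapsed_horn n n I m (po_inr _ _ m a))).
  rewrite collapsed_horn_inr [LHS]po_elim_inr (ord_map0 a (ord_const m ord0)).
  by rewrite [RHS]uz.
- rewrite -[LHS]/(f m (po_elim hE m (to_collapse _ m a))) [X in f m X](po_elim_inl hE).
  by rewrite /= app_act fx yE.
rewrite -[LHS]/(f m (po_elim hE m (po_inr _ _ m a))) [X in f m X](po_elim_inr hE).
rewrite (ord_map0 a (ord_const m ord0)) /= -uz uvE.
by rewrite collapsed_horn_inr.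
Qed.

Lemma marked_equivalence (x : X 3) :
  (forall t : ord_map 2 3, thin (act t x)) ->
  (forall e : ord_map 1 3, verts e = [:: 0; 2] \/ verts e = [:: 1; 3] ->
     degenerate (act e x)) ->
  forall e : ord_map 1 3, verts e = [:: 0; 1] -> marked (act e x).
Proof.
move=> x_thin x_deg e eE.
pose e02 := lmap 1 3 [:: 0; 2]; pose e13 := lmap 1 3 [:: 1; 3].
have E02 : verts e02 = [:: 0; 2] by apply: verts_lmap.
have E13 : verts e13 = [:: 1; 3] by apply: verts_lmap.
have /degenerate_edge[z ez] := x_deg e02 (or_introl E02).
have /degenerate_edge[z' ez'] := x_deg e13 (or_intror E13).
pose g := Q_map E02 E13 ez ez'.
have g_thin q : thin (g 2 q).
  by have [/thin_degenerate//|[s ->]] := Q_map_simplex E02 E13 ez ez' q isT.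
pose u := @marked_scaled_map X _ noneP (@allP _) g (fun e => False_ind _) (fun t _ => g_thin t).
pose p := @scaled_map _ (@allP _) B (sMap_comp f g) (fun t _ => sc_map_thin f (g_thin t)).
have [|h [hu _]] := proj1 (over_extension _ _ _) (f_lift (Gen_Q p)) u.
  by apply: scMap_eq; apply: sMap_eq.
have -> : act e x = app h (to_Q 1 e).
  rewrite -(Q_mapE E02 E13 ez ez'); symmetry.
  exact: (scMap_app (congr1 (fun g : msMap _ _ => ms_map g) hu) (to_Q 1 e)).
apply: (@ms_map_marked (marked_scaled _ _) _ h); right; exists e => //.
by rewrite /simp_of eE.
Qed.

Lemma marked_compose (x : X 2) : thin x ->
  (forall e : ord_map 1 2, verts e = [:: 0; 1] \/ verts e = [:: 1; 2] ->
     marked (act e x)) ->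
  forall e : ord_map 1 2, marked (act e x).
Proof.
move=> x_thin x_marked e.
have gT t : allP t -> thin (yoneda x 2 t) by move=> _; apply: thin_faces.
have gE d : simp_of [:: [:: 0; 1]; [:: 1; 2]] d -> marked (yoneda x 1 d).
  by rewrite /simp_of !inE => /orP[]/eqP dE; apply: x_marked; [left | right].
pose u := @marked_scaled_map X _ _ (simp_of [:: [:: 0; 1; 2]]) (yoneda x) gE (fun t _ => gT t I).
pose p := @scaled_map _ (@allP _) B (sMap_comp f (yoneda x)) (fun t _ => sc_map_thin f (gT t I)).
have [|h [hu _]] := proj1 (over_extension _ _ _) (f_lift (Gen_compose p)) u.
  by apply: scMap_eq; apply: sMap_eq.
have -> : act e x = app h (e : Delta 2 1).
  symmetry; exact: (scMap_app (congr1 (fun g : msMap _ _ => ms_map g) hu) (e : Delta 2 1)).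
by apply: (@ms_map_marked (marked_scaled _ _) _ h); right.
Qed.

(** All pairs added at the pivot 4 have as last edge one of 14, 24, 34,
    which are e or e', and the base simplex v is degenerate, so that all the
    triangles involved are thin. *)
Lemma cartesian_marked (e : X 1) : cartesian f e -> marked e.
Proof.
move=> eC; have [|e' [fe' e'e e'_marked]] := @marked_lift (target e) (f 1 e).
  by rewrite /target /endpoint app_act.
(* The faces d and d' are sent to the degenerate triangles with edges
   id, e, e and id, e', e'; the base simplex is their common image. *)
pose s := lmap 2 1 [:: 0; 0; 1]; have sE : verts s = [:: 0; 0; 1] by apply: verts_lmap.
pose d := lmap 2 4 [:: 0; 2; 4]; have dE : verts d = [:: 0; 2; 4] by apply: verts_lmap.
pose d' := lmap 2 4 [:: 1; 3; 4]; have d'E : verts d' = [:: 1; 3; 4] by apply: verts_lmap.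
pose c := lmap 4 1 [:: 0; 0; 0; 0; 1].
have cE : verts c = [:: 0; 0; 0; 0; 1] by apply: verts_lmap.
pose v := act c (f 1 e).
have d_inj : injective d by apply: verts_injective; rewrite dE.
have d'_inj : injective d' by apply: verts_injective; rewrite d'E.
pose top : ord_map 0 2 := ord_const 0 ord_max.
have topE : verts top = [:: 2] by rewrite verts_const.
have [|||||||||u [uK ud ud']] := @glue_along 4 X 2 d setT (represent (act s e)) 2 d'
  (act s e') 0 top top.
- by move=> S T; rewrite !inE.
- by move=> m l r t _; rewrite /represent act_comp.
- by [].
- by [].
- by apply: verts_inj; rewrite !verts_comp_nth topE dE d'E.
- apply/subsetP=> z; rewrite inE -!mem_verts verts_comp_nth topE dE d'E !inE /=.
  by case: z => [[|[|[|[|[|?]]]]] ?].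
- by move=> i j _; rewrite !ord1.
- by rewrite inE.
- rewrite /represent -!act_comp.
  have E (a : X 1) : act (ord_comp s top) a = target a.
    rewrite /target /endpoint; congr (act _ a); apply: verts_inj.
    by rewrite verts_comp_nth topE sE verts_const.
  by rewrite !E.
set K := _ :|: _ in uK.
have KE (S : {set 'I_5}) : (S \in K) = (S \subset supp d) || (S \subset supp d').
  by rewrite !inE andbT.
have Kc : complex K.
  apply: complexU (@complex_powerset _ _); apply: complex_push => S T; by rewrite !inE.
have mem_d (z : 'I_5) : (z \in supp d) = (val z \in [:: 0; 2; 4]) by rewrite -mem_verts dE.
have mem_d' (z : 'I_5) : (z \in supp d') = (val z \in [:: 1; 3; 4]) by rewrite -mem_verts d'E.
have piv : pivotal K setT ord_max.
  split=> // [S T _ _|S _ SK]; first by rewrite inE.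
  split; first by rewrite inE.
  apply: contra SK; rewrite !KE => /orP[SP|SP]; apply/orP; [left | right];
    apply/subsetP=> z zS; have [->|zm] := eqVneq z ord_max; rewrite ?mem_d ?mem_d' //;
    by have := subsetP SP z; rewrite ?mem_d ?mem_d' !inE zm zS; apply.
have uv : lift_on f K v u.
  split=> // m t; rewrite KE => /orP[]/ord_factor[//|q ->].
    rewrite ud ?inE // /represent !app_act -!act_comp; congr (act _ _); apply: verts_inj.
    by rewrite ord_compA !verts_comp_nth sE cE dE.
  rewrite ud' !app_act -!act_comp fe'; congr (act _ _); apply: verts_inj.
  by rewrite ord_compA !verts_comp_nth sE cE d'E.
have u_edge (t : ord_map 1 4) : verts t = [:: 0; 4] \/ verts t = [:: 2; 4] -> u 1 t = e.
  pose q l := lmap 1 2 l.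
  have qE l : l = [:: 0; 2] \/ l = [:: 1; 2] -> verts t = [seq nth 0 (verts d) i | i <- l] -> u 1 t = e.
    move=> lE tE; have ql : verts (q l) = l by case: lE => ->; apply: verts_lmap.
    have -> : t = ord_comp d (q l) by apply: verts_inj; rewrite verts_comp_nth ql.
    rewrite ud ?inE // -[RHS]act_id /represent; apply: act_verts.
    by rewrite ql sE verts_id1; case: lE => ->.
  by case=> tE; [apply: (qE [:: 0; 2]) | apply: (qE [:: 1; 2])]; rewrite ?tE ?dE //; [left | right].
have u_edge' (t : ord_map 1 4) : verts t = [:: 1; 4] \/ verts t = [:: 3; 4] -> u 1 t = e'.
  pose q l := lmap 1 2 l.
  have qE l : l = [:: 0; 2] \/ l = [:: 1; 2] -> verts t = [seq nth 0 (verts d') i | i <- l] -> u 1 t = e'.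
    move=> lE tE; have ql : verts (q l) = l by case: lE => ->; apply: verts_lmap.
    have -> : t = ord_comp d' (q l) by apply: verts_inj; rewrite verts_comp_nth ql.
    rewrite ud' -[RHS]act_id; apply: act_verts.
    by rewrite ql sE verts_id1; case: lE => ->.
  by case=> tE; [apply: (qE [:: 0; 2]) | apply: (qE [:: 1; 2])]; rewrite ?tE ?d'E //; [left | right].
have [|u' [u'T u'v] u'u] := right_pivot piv uv.
  move=> S _ SK mS; split=> [z _||t t0S t0m t1 t_last].
  - by rewrite -ltnS.
  - move: SK; rewrite KE negb_or => /andP[/subsetPn[z zS zd] /subsetPn[z' z'S z'd]].
    have [zz'|zz'] := ltnP z z'; [exists z, z' | exists z', z]; split=> //;
    by move: zd z'd zz'; rewrite mem_d mem_d' !inE /=; have := ltn_ord z; have := ltn_ord z'; lia.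
  have tE : verts t = [:: t (inord 0) : nat; 4] by rewrite verts_edge t1.
  have [t_even|t_odd] : (verts t = [:: 0; 4] \/ verts t = [:: 2; 4]) \/
      (verts t = [:: 1; 4] \/ verts t = [:: 3; 4]).
  - rewrite tE; move: t0m => /=; case: (t (inord 0) : nat) => [|[|[|[|?]]]] //; tauto.
  - split.
      rewrite KE; apply/orP; left; apply/subsetP=> z; rewrite mem_d -mem_verts.
      by case: t_even => ->; rewrite !inE => /orP[]->; rewrite ?orbT.
    right; rewrite u_edge //; split; first exact: cartesian_fills.
    by move=> r _ _ _; rewrite -act_comp; apply/thin_degenerate/degenerate_of_edge.
  split.
    rewrite KE; apply/orP; right; apply/subsetP=> z; rewrite mem_d' -mem_verts.
    by case: t_odd => ->; rewrite !inE => /orP[]->; rewrite ?orbT.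
  by left; rewrite u_edge' //; apply: marked_edge_strongly_cartesian.
pose x := u' 4 (ord_id 4).
have xE m (t : ord_map m 4) : act t x = u' m t.
  by rewrite -u'T ?inE // ord_comp_id.
have x_thin (t : ord_map 2 4) : thin (act t x).
  apply/f_thin; rewrite xE u'v ?inE // -act_comp.
  by apply/thin_degenerate/degenerate_of_edge.
have xd m (q : ord_map m 2) : act (ord_comp d q) x = act (ord_comp s q) e.
  rewrite xE u'u; first by rewrite ud ?inE // /represent act_comp.
  by rewrite KE supp_comp_sub.
have xd' m (q : ord_map m 2) : act (ord_comp d' q) x = act (ord_comp s q) e'.
  rewrite xE u'u; first by rewrite ud' act_comp.
  by rewrite KE supp_comp_sub orbT.
pose q01 := lmap 1 2 [:: 0; 1]; have q01E : verts q01 = [:: 0; 1] by apply: verts_lmap.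
pose q02 := lmap 1 2 [:: 0; 2]; have q02E : verts q02 = [:: 0; 2] by apply: verts_lmap.
have s02 : ord_comp s q02 = ord_id 1.
  by apply: verts_inj; rewrite verts_comp_nth sE q02E verts_id1.
(* The 3-simplex 0, 1, 2, 3 factors through Q. *)
pose g := lmap 3 4 [:: 0; 1; 2; 3]; have gE : verts g = [:: 0; 1; 2; 3] by apply: verts_lmap.
have x01 (t : ord_map 1 4) : verts t = [:: 0; 1] -> marked (act t x).
  move=> tE; pose i := lmap 1 3 [:: 0; 1]; have iE : verts i = [:: 0; 1] by apply: verts_lmap.
  rewrite -(@act_verts _ _ _ _ x g i t); last by rewrite gE iE tE.
  apply: marked_equivalence => // [r|r rE]; first by rewrite -act_comp.
  rewrite -act_comp; case: rE => rE.
    rewrite (_ : ord_comp g r = ord_comp d q01).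
      by rewrite xd; apply: (@const_degenerate _ _ _ _ _ 0); rewrite // verts_comp_nth sE q01E.
    by apply: verts_inj; rewrite !verts_comp_nth gE rE dE q01E.
  rewrite (_ : ord_comp g r = ord_comp d' q01).
    by rewrite xd'; apply: (@const_degenerate _ _ _ _ _ 0); rewrite // verts_comp_nth sE q01E.
  by apply: verts_inj; rewrite !verts_comp_nth gE rE d'E q01E.
(* The triangle 0, 1, 4 exhibits e as the composite of 01 and e'. *)
pose h := lmap 2 4 [:: 0; 1; 4]; have hE : verts h = [:: 0; 1; 4] by apply: verts_lmap.
rewrite (_ : e = act q02 (act h x)).
  apply: marked_compose => // r [] rE; rewrite -act_comp.
    by apply: x01; rewrite verts_comp_nth hE rE.
  rewrite (_ : ord_comp h r = ord_comp d' q02) ?xd' ?s02 ?act_id //.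
  by apply: verts_inj; rewrite !verts_comp_nth hE rE d'E q02E.
rewrite -act_comp (_ : ord_comp h q02 = ord_comp d q02) ?xd ?s02 ?act_id //.
by apply: verts_inj; rewrite !verts_comp_nth hE dE q02E.
Qed.

End ToFibration.

Theorem proposition2p4p5 (B : scSet) (hB : infty_bicategory B)
    (X : msSet) (f : scMap X B) (hf : detects_thin f) :
  (forall (A A' : msOverCat B) (j : hom A A'),
     outer_cartesian_anodyne j ->
     has_extension j (MsOver f : msOverCat B)) <->
  (outer_cartesian_fibration f /\
   forall e : X 1, marked e <-> cartesian f e).
Proof.
split=> [/anodyne_extension f_lift|[f_fib f_marked]]; last first.
  by apply/anodyne_extension; apply: lift_generator.
have f_marked (e : X 1) : marked e <-> cartesian f e.
  split=> [e_marked|]; last exact: cartesian_marked.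
  exact/strongly_cartesian_cartesian/(marked_edge_strongly_cartesian f_lift).
split=> //; split; last first.
  move=> x e ex; have [e' [fe' e'x e'_marked]] := marked_lift f_lift ex.
  by exists e'; split=> //; apply/f_marked.
have left := left_lifting f_lift; have right := right_lifting f_lift.
split=> //; split.
- exact: inner_lifting.
- by move=> n n2; apply: scaled_lifting => //; apply: left.
- by move=> n n2; apply: scaled_lifting => //; apply: right.
Qed.
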